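(* Let $p\in\mathbb Z_{>0}$ be odd and $r\in\mathbb C$. Then $$u_{p,r}=\sum_{i=0}^{\frac{p-1}{2}}\Psi\bigl(-i-\tfrac12\bigr)\,S_{\frac{p-1}{2}-i}\Bigl(-\tfrac{\alpha}{2c_{L,\alpha}}\Bigr)v_{p,r}$$ is a singular vector, of conformal weight $h_{p,r}+\frac p2=h_{p,r-1/2}$, in $V[p,r]\cong\mathcal F_{p,r}$.
   Context: The $N=1$ Heisenberg-Virasoro algebra $\mathcal{SH}$ is the complex Lie superalgebra with even basis elements $L(n),\alpha(n)$ ($n\in\mathbb Z$), odd basis elements $G(n+\frac12),\Psi(n+\frac12)$ ($n\in\mathbb Z$), and even central elements $C_L,C_\alpha,C_{L,\alpha}$, with (super)commutators, for $m,n\in\mathbb Z$: $[\alpha(m),\alpha(n)]=\delta_{m+n,0}\,m\,C_\alpha$; $[L(m),\alpha(n)]=-n\,\alpha(m+n)-\delta_{m+n,0}(m^2+m)C_{L,\alpha}$; $[L(m),L(n)]=(m-n)L(m+n)+\delta_{m+n,0}\frac{m^3-m}{12}C_L$; $[\Psi(m+\frac12),\Psi(n+\frac12)]_+=\delta_{m+n+1,0}C_\alpha$; $[\alpha(m),\Psi(n+\frac12)]=0$; $[G(m+\frac12),G(n+\frac12)]_+=2L(m+n+1)+\delta_{m+n+1,0}\frac{m^2+m}{3}C_L$; $[L(m),G(n+\frac12)]=(\frac m2-n-\frac12)G(m+n+\frac12)$; $[\alpha(m),G(n+\frac12)]=m\,\Psi(m+n+\frac12)$; $[\Psi(m+\frac12),L(n)]=\frac{2m+n+1}{2}\Psi(m+n+\frac12)$;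 $[\Psi(m+\frac12),G(n+\frac12)]_+=\alpha(m+n+1)+2m\,\delta_{m+n+1,0}C_{L,\alpha}$. Let $\mathcal{SH}^{+}$ be the span of $L(n),\alpha(n),G(n-\frac12),\Psi(n-\frac12)$, $n\ge1$. A singular vector is a nonzero vector annihilated by $\mathcal{SH}^+$. Fix $c_L,c_{L,\alpha}\in\mathbb C$ with $c_{L,\alpha}\ne0$. For $h,h_\alpha\in\mathbb C$, $V(h,h_\alpha)$ denotes the Verma module: the universal $\mathcal{SH}$-module generated by a vector $v$ with $\mathcal{SH}^+v=0$, $L(0)v=hv$, $\alpha(0)v=h_\alpha v$, on which $C_L,C_\alpha,C_{L,\alpha}$ act by $c_L,0,c_{L,\alpha}$. For $p,r\in\mathbb C$ put $h_{p,r}=(1-p^2)\frac{c_L-3}{24}-rp$ and $V[p,r]=V(h_{p,r},(1+p)c_{L,\alpha})$, with highest weight vector $v_{p,r}$. Conformal weight means $L(0)$-eigenvalue. For $p\notin\mathbb Z_{<0}$, $V[p,r]$ is isomorphic to the Fock module $\mathcal F_{p,r}$: the module over the Heisenberg algebra ($c(n),d(n)$; $\langle c,c\rangle=\langle d,d\rangle=0,\langle c,d\rangle=2$) and the fermions ($\Psi^\pm(s)$, $s\in\frac12+\mathbb Z$; $\{\Psi^+(r),\Psi^-(s)\}=\delta_{r+s,0}$, others zero) generated by the vacuum $v_{p,r}=e^{-\frac{p+1}2\overline d+rc}$, $\overline d=d-\frac{c_L-3}{12}c$, with $\alpha(n)=-c_{L,\alpha}c(n)$, $\Psi(s)=-\sqrt2c_{L,\alpha}\Psi^-(s)$,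 and $L(z)$, $G(z)$ the fields of the vectors $\omega=\frac12c(-1)d(-1)+\frac{c_L-3}{24}c(-2)-\frac12d(-2)+\frac12\Psi^+(-\frac32)\Psi^-(-\frac12)+\frac12\Psi^-(-\frac32)\Psi^+(-\frac12)$ and $\tau=\sqrt2(\frac12c(-1)\Psi^+(-\frac12)+\frac12d(-1)\Psi^-(-\frac12)+\frac{c_L-3}{12}\Psi^-(-\frac32)-\Psi^+(-\frac32))$. Schur polynomials: $S_k(\beta)=S_k(\beta(-1),\beta(-2),\dots)$ are defined by $\exp\left(\sum_{n\ge1}\beta(-n)\frac{z^n}{n}\right)=\sum_{k\ge0}S_k(\beta)z^k$; $S_k(-\frac{\alpha}{2c_{L,\alpha}})$ is obtained by substituting $\beta(-n)=-\frac{1}{2c_{L,\alpha}}\alpha(-n)$. *)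

(* Defs.v *)
From HB Require Import structures.
From mathcomp Require Import all_boot all_order all_algebra.
From mathcomp Require Import boolp reals complex finmap monalg ring.

Set Implicit Arguments.
Unset Strict Implicit.
Unset Printing Implicit Defensive.

Import Order.TTheory GRing.Theory Num.Theory.
Local Open Scope ring_scope.

(* Parities are booleans, [true] being odd. *)
Record lieSuperalgebra (K : numFieldType) := LieSuperalgebra {
  lsa_sort :> lmodType K;
  lsa_hom : bool -> lsa_sort -> Prop;
  lsa_br : lsa_sort -> lsa_sort -> lsa_sort;
  lsa_hom_linear : forall s (a : K) x y,
    lsa_hom s x -> lsa_hom s y -> lsa_hom s (a *: x + y);
  lsa_hom_sum : forall x, exists x0 x1,
    [/\ lsa_hom false x0, lsa_hom true x1 & x = x0 + x1];
  lsa_hom_direct : forall x, lsa_hom false x -> lsa_hom true x -> x = 0;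
  lsa_br_linearl : forall y, linear (lsa_br ^~ y);
  lsa_br_linearr : forall x, linear (lsa_br x);
  lsa_br_hom : forall s t x y,
    lsa_hom s x -> lsa_hom t y -> lsa_hom (s (+) t) (lsa_br x y);
  lsa_br_skew : forall s t x y, lsa_hom s x -> lsa_hom t y ->
    lsa_br y x = - ((-1) ^+ (s && t) *: lsa_br x y);
  lsa_jacobi : forall s t u x y z,
    lsa_hom s x -> lsa_hom t y -> lsa_hom u z ->
    lsa_br x (lsa_br y z) =
      lsa_br (lsa_br x y) z + (-1) ^+ (s && t) *: lsa_br y (lsa_br x z)
}.

(* No grading is imposed on modules: they are the left modules over the
   universal enveloping algebra. *)
Record lsaModule (K : numFieldType) (g : lieSuperalgebra K) := LsaModule {
  lsm_sort :> lmodType K;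
  lsm_act : g -> lsm_sort -> lsm_sort;
  lsm_act_linearl : forall w, linear (lsm_act ^~ w);
  lsm_act_linearr : forall x, linear (lsm_act x);
  lsm_act_br : forall s t (x y : g) w, lsa_hom s x -> lsa_hom t y ->
    lsm_act (lsa_br x y) w =
      lsm_act x (lsm_act y w) - (-1) ^+ (s && t) *: lsm_act y (lsm_act x w)
}.

Definition lsm_hom (K : numFieldType) (g : lieSuperalgebra K)
    (V W : lsaModule g) (f : V -> W) : Prop :=
  linear f /\ forall (x : g) w, f (lsm_act x w) = lsm_act x (f w).

Definition lsm_generated (K : numFieldType) (g : lieSuperalgebra K)
    (V : lsaModule g) (v : V) : Prop :=
  forall P : V -> Prop,
    P v ->
    (forall (a : K) w1 w2, P w1 -> P w2 -> P (a *: w1 + w2)) ->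
    (forall (x : g) w, P w -> P (lsm_act x w)) ->
  forall w, P w.

(* [bG n] and [bPsi n] stand for G(n+1/2) and Psi(n+1/2). *)
Variant sh_basis :=
  | bL of int | bAlpha of int | bG of int | bPsi of int
  | bCL | bCAlpha | bCLAlpha.

Definition sh_basis_code (b : sh_basis) : nat * int :=
  match b with
  | bL n => (0, n) | bAlpha n => (1, n) | bG n => (2, n) | bPsi n => (3, n)
  | bCL => (4, 0%Z) | bCAlpha => (5, 0%Z) | bCLAlpha => (6, 0%Z)
  end%N.

Definition sh_basis_decode (c : nat * int) : sh_basis :=
  match c with
  | (0, n) => bL n | (1, n) => bAlpha n | (2, n) => bG n | (3, n) => bPsi n
  | (4, _) => bCL | (5, _) => bCAlpha | (_, _) => bCLAlpha
  end%N.

Lemma sh_basis_codeK : cancel sh_basis_code sh_basis_decode.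
Proof. by case. Qed.

HB.instance Definition _ := Choice.copy sh_basis (can_type sh_basis_codeK).

Definition sh_odd (b : sh_basis) : bool :=
  match b with bG _ | bPsi _ => true | _ => false end.

Section LinearExtension.
Variables (K : numFieldType) (B : choiceType) (W : lmodType K).

Definition lin_ext (f : B -> W) (x : {malg K[B]}) : W :=
  \sum_(b <- msupp x) x@_b *: f b.

Lemma lin_extEw f (d : {fset B}) x : (msupp x `<=` d)%fset ->
  lin_ext f x = \sum_(b <- d) x@_b *: f b.
Proof.
move=> le; rewrite [LHS](big_fset_incl _ le) => //= b _ /mcoeff_outdom ->.
by rewrite scale0r.
Qed.

Lemma lin_ext_linear f : linear (lin_ext f).
Proof.
move=> a x y.
have sx : (msupp x `<=` msupp x `|` msupp y)%fset by exact: fsubsetUl.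
have sy : (msupp y `<=` msupp x `|` msupp y)%fset by exact: fsubsetUr.
have sz : (msupp (a *: x + y)%R `<=` msupp x `|` msupp y)%fset.
  apply: fsubset_trans (msuppD_le _ _) _.
  by apply: fsetUSS => //; exact: msuppZ_le.
rewrite (lin_extEw _ sx) (lin_extEw _ sy) (lin_extEw _ sz).
rewrite scaler_sumr -big_split; apply: eq_bigr => b _ /=.
by rewrite mcoeffD mcoeffZ scalerDl scalerA.
Qed.

Lemma lin_extU f b : lin_ext f << b >> = f b.
Proof.
by rewrite (lin_extEw _ msuppU_le) big_seq_fset1 mcoeffUU scale1r.
Qed.

End LinearExtension.

Section LinearProp.
Variables (K : numFieldType) (V W : lmodType K) (f : V -> W).
Hypothesis f_lin : linear f.

Lemma lin0 : f 0 = 0.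
Proof. by have := f_lin (-1) 0 0; rewrite scaler0 addr0 scaleN1r addNr. Qed.

Lemma linZ a x : f (a *: x) = a *: f x.
Proof. by have := f_lin a x 0; rewrite lin0 !addr0. Qed.

Lemma linD x y : f (x + y) = f x + f y.
Proof. by have := f_lin 1 x y; rewrite !scale1r. Qed.

Lemma linN x : f (- x) = - f x.
Proof. by rewrite -scaleN1r linZ scaleN1r. Qed.

End LinearProp.

Section LinearOps.
Variables (K : numFieldType) (U V W : lmodType K).

Lemma linear_comp (f : V -> W) (g : U -> V) :
  linear f -> linear g -> linear (fun x => f (g x)).
Proof. by move=> hf hg a x y; rewrite hg hf. Qed.

Lemma linear_add (f g : V -> W) :
  linear f -> linear g -> linear (fun x => f x + g x).
Proof.
move=> hf hg a x y; rewrite hf hg scalerDr -!addrA; congr (_ + _).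
by rewrite addrCA.
Qed.

Lemma linear_scale (c : K) (f : V -> W) :
  linear f -> linear (fun x => c *: f x).
Proof. by move=> hf a x y; rewrite hf scalerDr !scalerA mulrC. Qed.

Lemma linear_opp (f : V -> W) : linear f -> linear (fun x => - f x).
Proof. by move=> hf a x y; rewrite hf opprD scalerN. Qed.

End LinearOps.

Section BracketTable.
Variables (K : numFieldType) (V : lmodType K) (e : sh_basis -> V).

Definition delta (n : int) : K := (n == 0)%:R.

Definition br_L_L (m n : int) : V :=
  (m - n)%:~R *: e (bL (m + n))
  + (delta (m + n) * ((m ^+ 3 - m)%:~R / 12)) *: e bCL.

Definition br_L_Alpha (m n : int) : V :=
  - n%:~R *: e (bAlpha (m + n))
  - (delta (m + n) * (m ^+ 2 + m)%:~R) *: e bCLAlpha.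

Definition br_Alpha_Alpha (m n : int) : V :=
  (delta (m + n) * m%:~R) *: e bCAlpha.

Definition br_Psi_Psi (m n : int) : V := delta (m + n + 1) *: e bCAlpha.

Definition br_G_G (m n : int) : V :=
  2 *: e (bL (m + n + 1))
  + (delta (m + n + 1) * ((m ^+ 2 + m)%:~R / 3)) *: e bCL.

Definition br_L_G (m n : int) : V :=
  (m%:~R / 2 - n%:~R - 2^-1) *: e (bG (m + n)).

Definition br_Alpha_G (m n : int) : V := m%:~R *: e (bPsi (m + n)).

Definition br_Psi_L (m n : int) : V :=
  ((2 * m + n + 1)%:~R / 2) *: e (bPsi (m + n)).

Definition br_Psi_G (m n : int) : V :=
  e (bAlpha (m + n + 1)) + (2 * m%:~R * delta (m + n + 1)) *: e bCLAlpha.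

Definition sh_table (a b : sh_basis) : V :=
  match a, b with
  | bL m, bL n => br_L_L m n
  | bL m, bAlpha n => br_L_Alpha m n
  | bAlpha m, bL n => - br_L_Alpha n m
  | bL m, bG n => br_L_G m n
  | bG m, bL n => - br_L_G n m
  | bPsi m, bL n => br_Psi_L m n
  | bL m, bPsi n => - br_Psi_L n m
  | bAlpha m, bAlpha n => br_Alpha_Alpha m n
  | bAlpha m, bG n => br_Alpha_G m n
  | bG m, bAlpha n => - br_Alpha_G n m
  | bAlpha _, bPsi _ | bPsi _, bAlpha _ => 0
  | bG m, bG n => br_G_G m n
  | bPsi m, bPsi n => br_Psi_Psi m n
  | bPsi m, bG n => br_Psi_G m n
  | bG m, bPsi n => br_Psi_G n m
  | bCL, _ | bCAlpha, _ | bCLAlpha, _ => 0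
  | _, bCL | _, bCAlpha | _, bCLAlpha => 0
  end.

End BracketTable.


Lemma deltaP (K : numFieldType) s :
  (delta K s = 1 /\ s = 0) \/ delta K s = 0.
Proof. by rewrite /delta; case: eqP => [->|_]; [left | right]. Qed.

Lemma deltaP' (K : numFieldType) s :
  (delta K (s + 1) = 1 /\ s = -1) \/ delta K (s + 1) = 0.
Proof.
rewrite /delta; case: eqP => [e|_]; [left; split => // | by right].
by apply/eqP; rewrite -addr_eq0 e.
Qed.

Section JacobiTable.
Variables (K : numFieldType) (V : lmodType K) (e : sh_basis -> V).
Variable br : V -> V -> V.
Hypothesis br_e : forall a b, br (e a) (e b) = sh_table e a b.
Hypothesis brDr : forall x y z, br x (y + z) = br x y + br x z.
Hypothesis brZr : forall a x y, br x (a *: y) = a *: br x y.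
Hypothesis brNr : forall x y, br x (- y) = - br x y.
Hypothesis brDl : forall x y z, br (y + z) x = br y x + br z x.
Hypothesis brZl : forall a x y, br (a *: y) x = a *: br y x.
Hypothesis brNl : forall x y, br (- y) x = - br y x.
Hypothesis brCl : forall x,
  [/\ br (e bCL) x = 0, br (e bCAlpha) x = 0 & br (e bCLAlpha) x = 0].
Hypothesis brCr : forall x,
  [/\ br x (e bCL) = 0, br x (e bCAlpha) = 0 & br x (e bCLAlpha) = 0].
Variables (f : sh_basis -> K) (F : V -> K).
Hypothesis F0 : F 0 = 0.
Hypothesis FD : forall u v, F (u + v) = F u + F v.
Hypothesis FZ : forall a u, F (a *: u) = a * F u.
Hypothesis FN : forall u, F (- u) = - F u.
Hypothesis FE : forall b, F (e b) = f b.

Lemma jacobi_table a b c :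
  F (br (e a) (br (e b) (e c))) =
  F (br (br (e a) (e b)) (e c)
    + (-1) ^+ (sh_odd a && sh_odd b) *: br (e b) (br (e a) (e c))).
Proof.
have z1 x : br (e bCL) x = 0 by case: (brCl x).
have z2 x : br (e bCAlpha) x = 0 by case: (brCl x).
have z3 x : br (e bCLAlpha) x = 0 by case: (brCl x).
have w1 x : br x (e bCL) = 0 by case: (brCr x).
have w2 x : br x (e bCAlpha) = 0 by case: (brCr x).
have w3 x : br x (e bCLAlpha) = 0 by case: (brCr x).
have br0r x : br x 0 = 0 by have := brZr 0 x 0; rewrite !scale0r.
have br0l x : br 0 x = 0 by have := brZl 0 x 0; rewrite !scale0r.
have zz := (z1, z2, z3, w1, w2, w3, br0l, br0r, scaler0, addr0).
case: a => [m|m|m|m|||]; [ | | | | by rewrite !zz | by rewrite !zz | by rewrite !zz].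
all: case: b => [n|n|n|n|||]; [ | | | | by rewrite !zz | by rewrite !zz | by rewrite !zz].
all: case: c => [p|p|p|p|||]; [ | | | | by rewrite !zz | by rewrite !zz | by rewrite !zz].
all: have [s ms] : {s | m = s - n - p} by exists (m + n + p); ring.
all: rewrite {m}ms.
all: do 3 rewrite -> br_e; cbn [sh_table sh_odd andb];
  rewrite /br_L_L /br_L_Alpha /br_Alpha_Alpha /br_Psi_Psi /br_G_G
    /br_L_G /br_Alpha_G /br_Psi_L /br_Psi_G.
all: repeat first [rewrite -> brDr | rewrite -> brDl | rewrite -> brZr
  | rewrite -> brZl | rewrite -> brNr | rewrite -> brNl | rewrite -> w1
  | rewrite -> w2 | rewrite -> w3 | rewrite -> z1 | rewrite -> z2
  | rewrite -> z3 | rewrite -> br0l | rewrite -> br0r].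
all: repeat rewrite -> br_e; cbn [sh_table];
  rewrite /br_L_L /br_L_Alpha /br_Alpha_Alpha /br_Psi_Psi /br_G_G
    /br_L_G /br_Alpha_G /br_Psi_L /br_Psi_G.
all: repeat first
  [rewrite -> FD | rewrite -> FZ | rewrite -> FN | rewrite -> F0].
all: repeat rewrite -> FE; rewrite ?expr0 ?expr1.
all: repeat match goal with
  | |- context [f (_ ?i)] =>
     first [ constr_eq i s; fail 1 | constr_eq i (s + 1); fail 1
     | rewrite (_ : i = s); last ring | rewrite (_ : i = s + 1); last ring ]
  | |- context [delta _ ?i] =>
     first [ constr_eq i s; fail 1 | constr_eq i (s + 1); fail 1
     | rewrite (_ : i = s); last ring | rewrite (_ : i = s + 1); last ring ]
  end.
all: try by ring.
all: try by field.
all: try by case: (deltaP K s) => [[-> ->]|->]; field.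
all: try by case: (deltaP' K s) => [[-> ->]|->]; field.
Qed.
End JacobiTable.

Section SH.
Variable K : numFieldType.

Definition sh_space : lmodType K := {malg K[sh_basis]}.

Definition eB (b : sh_basis) : sh_space := mkmalgU b 1.

Definition sh_br (x y : sh_space) : sh_space :=
  lin_ext (fun a => lin_ext ((sh_table eB) a) y) x.

Definition sh_hom (s : bool) (x : sh_space) : Prop :=
  forall b, b \in msupp x -> sh_odd b = s.

Lemma sh_br_linearl y : linear (sh_br ^~ y).
Proof. exact: lin_ext_linear. Qed.

Lemma sh_br_linearr x : linear (sh_br x).
Proof.
move=> a y z; rewrite /sh_br /lin_ext scaler_sumr -big_split.
apply: eq_bigr => b _ /=.
by rewrite [\sum_(i <- msupp (_ + _)) _](lin_ext_linear _ a y z) scalerDr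
  !scalerA mulrC.
Qed.

Lemma sh_br_eB a b : sh_br (eB a) (eB b) = sh_table eB a b.
Proof. by rewrite /sh_br lin_extU lin_extU. Qed.

Lemma sh_homP s x :
  sh_hom s x <-> forall b, sh_odd b != s -> x@_b = 0.
Proof.
split=> h b.
  by move=> bs; apply: mcoeff_outdom; apply: contraNN bs => /h ->.
by rewrite -mcoeff_neq0; apply: contraNeq => /h ->.
Qed.

Lemma sh_hom_linear s (a : K) x y :
  sh_hom s x -> sh_hom s y -> sh_hom s (a *: x + y).
Proof.
move=> /sh_homP hx /sh_homP hy; apply/sh_homP => b bs.
by rewrite mcoeffD mcoeffZ hx // hy // mulr0 addr0.
Qed.

Lemma sh_hom0 s : sh_hom s 0.
Proof. by apply/sh_homP => b _; rewrite mcoeff0. Qed.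

Lemma sh_hom_eB b : sh_hom (sh_odd b) (eB b).
Proof.
by move=> c /(fsubsetP msuppU_le); rewrite in_fset1 => /eqP ->.
Qed.

Lemma sh_hom_ind s (P : sh_space -> Prop) :
  P 0 -> (forall (a : K) x y, P x -> P y -> P (a *: x + y)) ->
  (forall b, sh_odd b = s -> P (eB b)) -> forall x, sh_hom s x -> P x.
Proof.
move=> P0 PD Pb x hx; rewrite [x]monalgE.
set l := (X in \sum_(_ <- X) _); have sub : {subset l <= msupp x} by [].
elim: l sub => [|b l IH] sub; first by rewrite big_nil.
rewrite big_cons; have -> : << x@_b *g b >> = x@_b *: eB b.
  by apply/malgP => k; rewrite mcoeffZ !mcoeffU mulr_natr.
apply: PD; last by apply: IH => c cl; apply: sub; rewrite inE cl orbT.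
by apply/Pb/hx/sub; rewrite inE eqxx.
Qed.

Lemma sh_hom_sum x : exists x0 x1,
  [/\ sh_hom false x0, sh_hom true x1 & x = x0 + x1].
Proof.
pose part s : sh_space := [malg b in msupp x => x@_b *+ (sh_odd b == s)].
have partE s b : (part s)@_b = x@_b *+ (sh_odd b == s).
  by rewrite mcoeffE; case: msuppP; rewrite ?mul0rn.
exists (part false), (part true); split.
- by apply/sh_homP => b /negPf; rewrite partE => ->.
- by apply/sh_homP => b /negPf; rewrite partE => ->.
by apply/malgP => b; rewrite mcoeffD !partE; case: sh_odd; rewrite ?addr0 ?add0r.
Qed.

Lemma sh_hom_direct x : sh_hom false x -> sh_hom true x -> x = 0.
Proof.
move=> /sh_homP h0 /sh_homP h1; apply/malgP => b; rewrite mcoeff0.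
by case E : (sh_odd b); [apply: h0 | apply: h1]; rewrite E.
Qed.

Lemma sh_br_hom s t x y :
  sh_hom s x -> sh_hom t y -> sh_hom (s (+) t) (sh_br x y).
Proof.
have hU b : sh_hom (sh_odd b) (eB b) by exact: sh_hom_eB.
have hZ r (a : K) z : sh_hom r z -> sh_hom r (a *: z).
  by move=> hz; rewrite -[_ *: _]addr0; apply: sh_hom_linear => //; apply: sh_hom0.
have hD r z1 z2 : sh_hom r z1 -> sh_hom r z2 -> sh_hom r (z1 + z2).
  by move=> h1 h2; rewrite -[z1]scale1r; apply: sh_hom_linear.
have hN r z : sh_hom r z -> sh_hom r (- z).
  by move=> h1; rewrite -scaleN1r; apply: hZ.
have h0 r : sh_hom r 0 by exact: sh_hom0.
have main a b : sh_hom (sh_odd a (+) sh_odd b) (sh_table eB a b).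
  case: a => [m|m|m|m|||]; case: b => [n|n|n|n|||];
  rewrite /= ?/br_L_L ?/br_L_Alpha ?/br_Alpha_Alpha ?/br_Psi_Psi ?/br_G_G
    ?/br_L_G ?/br_Alpha_G ?/br_Psi_L ?/br_Psi_G //;
  by repeat match goal with
    | |- sh_hom _ 0 => exact: h0
    | |- sh_hom _ (- _) => apply hN
    | |- sh_hom _ (_ *: _) => apply hZ
    | |- sh_hom _ (_ + _) => apply hD
    | |- sh_hom _ (?f ?n) => exact (hU (_ n))
    | |- sh_hom _ ?f => exact (hU _)
    end.
move=> hx hy; move: x hx; apply: sh_hom_ind => [|c u v hu hv|a <-].
- by rewrite (lin0 (sh_br_linearl y)).
- by rewrite (sh_br_linearl y); apply: sh_hom_linear.
move: y hy; apply: sh_hom_ind => [|c u v hu hv|b <-].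
- by rewrite (lin0 (sh_br_linearr _)).
- by rewrite (sh_br_linearr _); apply: sh_hom_linear.
by rewrite sh_br_eB.
Qed.

Lemma sh_space_ext (x y : sh_space) :
  (forall (f : sh_basis -> K) (F : sh_space -> K),
    F 0 = 0 ->
    (forall u v, F (u + v) = F u + F v) ->
    (forall a u, F (a *: u) = a * F u) -> (forall u, F (- u) = - F u) ->
    (forall b, F (eB b) = f b) -> F x = F y) -> x = y.
Proof.
move=> h; apply/malgP => k; apply: (h (fun b => (eB b)@_k)) => //.
- exact: mcoeff0.
- exact: mcoeffD.
- by move=> a u; exact: mcoeffZ.
- exact: mcoeffN.
Qed.

Lemma sh_br_skew_basis a b :
  sh_table eB b a = - ((-1) ^+ (sh_odd a && sh_odd b) *: sh_table eB a b).
Proof.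
have subst (m n c : int) : m + n + c = 0 -> n = - m - c.
  by move=> e; have : n = (m + n + c) - m - c; [ring | rewrite e sub0r].
case: a => [m|m|m|m|||]; case: b => [n|n|n|n|||];
  rewrite /= ?expr0 ?expr1 ?scale1r ?scaleN1r ?opprK ?oppr0 //;
  rewrite /br_L_L /br_Alpha_Alpha /br_G_G /br_Psi_Psi /delta (addrC n m);
  apply: sh_space_ext => f F F0 FD FZ FN FE;
  rewrite ?(F0, FD, FZ, FN, FE) {F F0 FD FZ FN FE}.
- case: eqP => [e|_] /=; last by ring.
  by have -> : n = - m - 0; [apply: subst; rewrite addr0 | ring].
- case: eqP => [e|_] /=; last by ring.
  by have -> : n = - m - 0; [apply: subst; rewrite addr0 | ring].
- case: eqP => [e|_] /=; last by ring.
  by have -> : n = - m - 1; [apply: subst | ring].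
- by [].
Qed.

Lemma sh_br0r x : sh_br x 0 = 0.
Proof. exact: (lin0 (sh_br_linearr x)). Qed.
Lemma sh_brDr x y z : sh_br x (y + z) = sh_br x y + sh_br x z.
Proof. exact: (linD (sh_br_linearr x)). Qed.
Lemma sh_brZr a x y : sh_br x (a *: y) = a *: sh_br x y.
Proof. exact: (linZ (sh_br_linearr x)). Qed.
Lemma sh_brNr x y : sh_br x (- y) = - sh_br x y.
Proof. exact: (linN (sh_br_linearr x)). Qed.
Lemma sh_br0l x : sh_br 0 x = 0.
Proof. exact: (lin0 (sh_br_linearl x)). Qed.
Lemma sh_brDl x y z : sh_br (y + z) x = sh_br y x + sh_br z x.
Proof. exact: (linD (sh_br_linearl x)). Qed.
Lemma sh_brZl a x y : sh_br (a *: y) x = a *: sh_br y x.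
Proof. exact: (linZ (sh_br_linearl x)). Qed.
Lemma sh_brNl x y : sh_br (- y) x = - sh_br y x.
Proof. exact: (linN (sh_br_linearl x)). Qed.

Definition sh_brE := (sh_br0r, sh_brDr, sh_brZr, sh_brNr,
  sh_br0l, sh_brDl, sh_brZl, sh_brNl, sh_br_eB).

Lemma sh_hom_ext s (W : lmodType K) (F G : sh_space -> W) :
  linear F -> linear G ->
  (forall b, sh_odd b = s -> F (eB b) = G (eB b)) ->
  forall x, sh_hom s x -> F x = G x.
Proof.
move=> hF hG h; apply: sh_hom_ind => // [|a x y hx hy].
  by rewrite (lin0 hF) (lin0 hG).
by rewrite hF hG hx hy.
Qed.

Lemma sh_br_skew s t x y : sh_hom s x -> sh_hom t y ->
  sh_br y x = - ((-1) ^+ (s && t) *: sh_br x y).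
Proof.
move=> hx hy; move: x hx; apply: sh_hom_ext => [||a <-].
- exact: sh_br_linearr.
- exact/linear_opp/linear_scale/sh_br_linearl.
move: y hy; apply: sh_hom_ext => [||b <-].
- exact: sh_br_linearl.
- exact/linear_opp/linear_scale/sh_br_linearr.
by rewrite !sh_br_eB sh_br_skew_basis.
Qed.

Lemma sh_jacobi_basis a b c :
  sh_br (eB a) (sh_br (eB b) (eB c)) =
    sh_br (sh_br (eB a) (eB b)) (eB c)
    + (-1) ^+ (sh_odd a && sh_odd b) *: sh_br (eB b) (sh_br (eB a) (eB c)).
Proof.
have zl d : (sh_table eB d =1 fun=> 0) -> forall x, sh_br (eB d) x = 0.
  move=> h x; rewrite /sh_br lin_extU /lin_ext big1 // => i _.
  by rewrite h scaler0.
have zr d : (forall e, sh_table eB e d = 0) -> forall x, sh_br x (eB d) = 0.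
  move=> h x; rewrite /sh_br /lin_ext big1 // => i _.
  by rewrite [\sum_(_ <- _) _]lin_extU h scaler0.
apply: sh_space_ext => f F F0 FD FZ FN FE.
apply: (@jacobi_table _ _ eB sh_br _ _ _ _ _ _ _ _ _ f F) => //.
- exact: sh_br_eB.
- exact: sh_brDr.
- by move=> *; exact: sh_brZr.
- exact: sh_brNr.
- by move=> x y z; exact: sh_brDl.
- by move=> a0 x y; exact: sh_brZl.
- by move=> x y; exact: sh_brNl.
- by move=> x; split; apply: zl.
by move=> x; split; apply: zr => -[].
Qed.

Lemma sh_jacobi s t u x y z :
  sh_hom s x -> sh_hom t y -> sh_hom u z ->
  sh_br x (sh_br y z) =
    sh_br (sh_br x y) z + (-1) ^+ (s && t) *: sh_br y (sh_br x z).
Proof.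
pose brl := sh_br_linearl; pose brr := sh_br_linearr.
move=> hx hy hz; move: x hx; apply: sh_hom_ext => [||a <-].
- exact: brl.
- apply: linear_add; first exact: (linear_comp (brl z) (brl y)).
  exact/linear_scale/(linear_comp (brr y) (brl z)).
move: y hy; apply: sh_hom_ext => [||b <-].
- exact: (linear_comp (brr _) (brl _)).
- apply: linear_add; first exact: (linear_comp (brl z) (brr _)).
  exact/linear_scale/brl.
move: z hz; apply: sh_hom_ext => [||c _].
- exact: (linear_comp (brr _) (brr _)).
- apply: linear_add; first exact: brr.
  exact/linear_scale/(linear_comp (brr _) (brr _)).
exact: sh_jacobi_basis.
Qed.

Definition SH : lieSuperalgebra K := LieSuperalgebra sh_hom_linear sh_hom_sum
  sh_hom_direct sh_br_linearl sh_br_linearr sh_br_hom sh_br_skew sh_jacobi.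

Definition eL (n : int) : SH := eB (bL n).
Definition eAlpha (n : int) : SH := eB (bAlpha n).
Definition eG (n : int) : SH := eB (bG n).
Definition ePsi (n : int) : SH := eB (bPsi n).
Definition eCL : SH := eB bCL.
Definition eCAlpha : SH := eB bCAlpha.
Definition eCLAlpha : SH := eB bCLAlpha.

(* [bG n] and [bPsi n] with [0 <= n] are G(n'-1/2) and Psi(n'-1/2) for
   n' = n + 1 >= 1. *)
Definition sh_plus_basis (b : sh_basis) : bool :=
  match b with
  | bL n | bAlpha n => 0 < n
  | bG n | bPsi n => 0 <= n
  | _ => false
  end.

Definition sh_plus (x : SH) : Prop :=
  forall b, b \in msupp (x : {malg K[sh_basis]}) -> sh_plus_basis b.

Definition singular_vector (V : lsaModule SH) (u : V) : Prop :=
  u != 0 /\ forall x : SH, sh_plus x -> lsm_act x u = 0.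

Definition conformal_weight (V : lsaModule SH) (u : V) (h : K) : Prop :=
  lsm_act (eL 0) u = h *: u.

Record highest_weight (cL cLA h hA : K) (V : lsaModule SH) (v : V) : Prop :=
  HighestWeight {
    hw_plus : forall x : SH, sh_plus x -> lsm_act x v = 0;
    hw_L0 : lsm_act (eL 0) v = h *: v;
    hw_alpha0 : lsm_act (eAlpha 0) v = hA *: v;
    hw_CL : forall w : V, lsm_act eCL w = cL *: w;
    hw_CAlpha : forall w : V, lsm_act eCAlpha w = 0;
    hw_CLAlpha : forall w : V, lsm_act eCLAlpha w = cLA *: w
  }.

(* The pair (V, v) is a realization of the Verma module V(h, hA), which is
   determined by this property up to a unique isomorphism. *)
Record is_verma (cL cLA h hA : K) (V : lsaModule SH) (v : V) : Prop :=
  IsVerma {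
    verma_hw : highest_weight cL cLA h hA v;
    verma_generated : lsm_generated v;
    verma_universal : forall (W : lsaModule SH) (w : W),
      highest_weight cL cLA h hA w -> exists f : V -> W, lsm_hom f /\ f v = w
  }.

Definition h_pr (cL p r : K) : K := (1 - p ^+ 2) * ((cL - 3) / 24) - r * p.

Definition is_verma_pr (cL cLA p r : K) (V : lsaModule SH) (v : V) : Prop :=
  is_verma cL cLA (h_pr cL p r) ((1 + p) * cLA) v.

End SH.

(* Formal power series in z with operators on V as coefficients. *)
Section OperatorSeries.
Variables (K : numFieldType) (V : lmodType K).
Implicit Types f g : nat -> V -> V.

Definition ops_one : nat -> V -> V := fun k w => if k == 0%N then w else 0.

Definition ops_mul f g : nat -> V -> V :=
  fun k w => \sum_(i < k.+1) f i (g (k - i)%N w).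

(* For [f] without constant term, [f ^ j] has no term of degree k < j, so that
   the z^k coefficient of the exponential is the finite sum below. *)
Definition ops_exp f : nat -> V -> V :=
  fun k w => \sum_(j < k.+1) (j`!%:R)^-1 *: iter j (ops_mul f) ops_one k w.

(* [beta n] stands for the operator beta(-n). *)
Definition schur (beta : nat -> V -> V) : nat -> V -> V :=
  ops_exp (fun n w => if n == 0%N then 0 else n%:R^-1 *: beta n w).

End OperatorSeries.

Section SingularVector.
Variables (K : numFieldType) (cLA : K) (V : lsaModule (SH K)).

Definition schur_alpha : nat -> V -> V :=
  schur (fun n w => - (2 * cLA)^-1 *: lsm_act (eAlpha K (- n%:Z)) w).

(* Psi(-i-1/2) is Psi(n+1/2) for n = -i-1. *)
Definition u_pr (p : nat) (v : V) : V :=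
  \sum_(i < (p.-1)./2.+1)
    lsm_act (ePsi K (- i%:Z - 1)) (schur_alpha ((p.-1)./2 - i) v).

End SingularVector.

Section ModuleFromBasis.
Variables (K : numFieldType) (V : lmodType K) (act : SH K -> V -> V).
Hypothesis act_linearl : forall w, linear (act ^~ w).
Hypothesis act_linearr : forall x, linear (act x).
Hypothesis act_basis : forall a b w,
  act (sh_table (@eB K) a b) w =
    act (eB K a) (act (eB K b) w)
    - (-1) ^+ (sh_odd a && sh_odd b) *: act (eB K b) (act (eB K a) w).

Lemma sh_act_br s t (x y : SH K) w : lsa_hom s x -> lsa_hom t y ->
  act (lsa_br x y) w =
    act x (act y w) - (-1) ^+ (s && t) *: act y (act x w).
Proof.
move=> hx hy; move: x hx; apply: sh_hom_ext => [||a <-].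
- exact: (linear_comp (act_linearl w) (sh_br_linearl y)).
- apply: linear_add; first exact: act_linearl.
  exact/linear_opp/linear_scale/(linear_comp (act_linearr y) (act_linearl w)).
move: y hy; apply: sh_hom_ext => [||b <-].
- exact: (linear_comp (act_linearl w) (sh_br_linearr _)).
- apply: linear_add; last exact/linear_opp/linear_scale/act_linearl.
  exact: (linear_comp (act_linearr _) (act_linearl w)).
by rewrite [lsa_br _ _]sh_br_eB act_basis.
Qed.

Definition sh_module : lsaModule (SH K) :=
  LsaModule act_linearl act_linearr sh_act_br.

End ModuleFromBasis.

Section VermaExists.
Variables (K : numFieldType) (cL cLA h hA : K).

Definition verma_free : lmodType K := {malg K[seq sh_basis]}.

Definition verma_word (s : seq sh_basis) : verma_free := mkmalgU s 1.

Definition verma_op (b : sh_basis) : verma_free -> verma_free :=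
  lin_ext (fun s => verma_word (b :: s)).

Definition verma_free_act (x : SH K) (m : verma_free) : verma_free :=
  lin_ext (fun b => verma_op b m) x.

Inductive verma_null : verma_free -> Prop :=
  | verma_null0 : verma_null 0
  | verma_null_linear a x y :
      verma_null x -> verma_null y -> verma_null (a *: x + y)
  | verma_null_op b x : verma_null x -> verma_null (verma_op b x)
  | verma_null_br a b m : verma_null
      (verma_free_act (sh_table (@eB K) a b) m - (verma_op a (verma_op b m)
         - (-1) ^+ (sh_odd a && sh_odd b) *: verma_op b (verma_op a m)))
  | verma_null_plus b :
      sh_plus_basis b -> verma_null (verma_op b (verma_word [::]))
  | verma_null_L0 :
      verma_null (verma_op (bL 0) (verma_word [::]) - h *: verma_word [::])
  | verma_null_alpha0 :
      verma_null (verma_op (bAlpha 0) (verma_word [::]) - hA *: verma_word [::])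
  | verma_null_CL m : verma_null (verma_op bCL m - cL *: m)
  | verma_null_CAlpha m : verma_null (verma_op bCAlpha m)
  | verma_null_CLAlpha m : verma_null (verma_op bCLAlpha m - cLA *: m).

Definition verma_pred : {pred verma_free} := [pred m | `[< verma_null m >]].

Lemma verma_predP m : reflect (verma_null m) (m \in verma_pred).
Proof. exact: asboolP. Qed.

Lemma verma_zmod_closed : zmod_closed verma_pred.
Proof.
split; first by apply/verma_predP; exact: verma_null0.
move=> x y /verma_predP hx /verma_predP hy; apply/verma_predP.
by rewrite addrC -scaleN1r; apply: verma_null_linear.
Qed.

HB.instance Definition _ :=
  GRing.isZmodClosed.Build verma_free verma_pred verma_zmod_closed.

Definition verma_quot : Type := Quotient.quot verma_pred.
HB.instance Definition _ := GRing.Zmodule.on verma_quot.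

Definition verma_pi (m : verma_free) : verma_quot :=
  \pi_(Quotient.quot verma_pred)%qT m.
Definition verma_repr (q : verma_quot) : verma_free :=
  repr (q : Quotient.quot verma_pred).

Lemma verma_reprK q : verma_pi (verma_repr q) = q.
Proof. exact: reprK. Qed.

Lemma verma_piP x y : verma_pi x = verma_pi y <-> verma_null (x - y).
Proof.
split=> [e|/verma_predP e].
  by apply/verma_predP; rewrite Quotient.idealrBE; apply/eqP.
by apply/eqP; rewrite -Quotient.idealrBE.
Qed.

Lemma verma_piD x y : verma_pi (x + y) = verma_pi x + verma_pi y.
Proof. exact: raddfD. Qed.

Lemma verma_null_repr x : verma_null (verma_repr (verma_pi x) - x).
Proof. by apply/verma_piP; rewrite verma_reprK. Qed.

Definition verma_scale (a : K) (q : verma_quot) : verma_quot :=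
  verma_pi (a *: verma_repr q).

Lemma verma_null_scale a x : verma_null x -> verma_null (a *: x).
Proof.
by move=> hx; rewrite -[_ *: _]addr0; apply: verma_null_linear => //; exact: verma_null0.
Qed.

Lemma verma_piZ a x : verma_scale a (verma_pi x) = verma_pi (a *: x).
Proof.
by apply/verma_piP; rewrite -scalerBr; exact/verma_null_scale/verma_null_repr.
Qed.

Lemma verma_quotW (P : verma_quot -> Prop) :
  (forall m, P (verma_pi m)) -> forall q, P q.
Proof. by move=> hP q; rewrite -(verma_reprK q). Qed.

Lemma verma_scaleA a b q :
  verma_scale a (verma_scale b q) = verma_scale (a * b) q.
Proof.
by move: q; apply: verma_quotW => m; rewrite !verma_piZ scalerA.
Qed.

Lemma verma_scale1 : left_id 1 verma_scale.
Proof. by apply: verma_quotW => m; rewrite verma_piZ scale1r. Qed.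

Lemma verma_scaleDr : right_distributive verma_scale +%R.
Proof.
move=> a; apply: verma_quotW => x; apply: verma_quotW => y.
by rewrite -verma_piD !verma_piZ -verma_piD scalerDr.
Qed.

Lemma verma_scaleDl q : {morph verma_scale^~ q : a b / a + b}.
Proof.
move=> a b; move: q; apply: verma_quotW => m.
by rewrite !verma_piZ -verma_piD scalerDl.
Qed.

HB.instance Definition _ := GRing.Zmodule_isLmodule.Build K verma_quot
  verma_scaleA verma_scale1 verma_scaleDr verma_scaleDl.

Lemma verma_pi_linear : linear verma_pi.
Proof. by move=> a x y; rewrite verma_piD -verma_piZ. Qed.

Lemma verma_op_linear b : linear (verma_op b).
Proof. exact: lin_ext_linear. Qed.

Lemma verma_free_act_linearl m : linear (verma_free_act ^~ m).
Proof. exact: lin_ext_linear. Qed.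

Lemma verma_free_act_eB b m : verma_free_act (eB K b) m = verma_op b m.
Proof. exact: lin_extU. Qed.

Lemma sh_basis_ext (W : lmodType K) (F G : SH K -> W) :
  linear F -> linear G -> (forall b, F (eB K b) = G (eB K b)) ->
  forall x, F x = G x.
Proof.
move=> hF hG hFG x; have [x0 [x1 [h0 h1 ->]]] := sh_hom_sum x.
rewrite (linD hF) (linD hG); congr (_ + _).
  by apply: (sh_hom_ext hF hG _ h0) => b _.
by apply: (sh_hom_ext hF hG _ h1) => b _.
Qed.

Lemma verma_free_act_linearr x : linear (verma_free_act x).
Proof.
move=> a m1 m2; move: x; apply: sh_basis_ext => [||b].
- exact: verma_free_act_linearl.
- apply: linear_add; last exact: verma_free_act_linearl.
  exact/linear_scale/verma_free_act_linearl.
by rewrite !verma_free_act_eB verma_op_linear.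
Qed.

Lemma verma_null_act x m : verma_null m -> verma_null (verma_free_act x m).
Proof.
move=> hm; rewrite /verma_free_act /lin_ext.
elim: (enum_fset _) => [|b l IH]; first by rewrite big_nil; exact: verma_null0.
by rewrite big_cons; apply: verma_null_linear => //; exact: verma_null_op.
Qed.

Definition verma_act (x : SH K) (q : verma_quot) : verma_quot :=
  verma_pi (verma_free_act x (verma_repr q)).

Lemma verma_act_pi x m : verma_act x (verma_pi m) = verma_pi (verma_free_act x m).
Proof.
apply/verma_piP; rewrite -(linN (verma_free_act_linearr x)).
rewrite -(linD (verma_free_act_linearr x)).
exact/verma_null_act/verma_null_repr.
Qed.

Lemma verma_act_linearl q : linear (verma_act ^~ q).
Proof. exact: (linear_comp verma_pi_linear (verma_free_act_linearl _)). Qed.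

Lemma verma_act_linearr x : linear (verma_act x).
Proof.
move=> a; apply: verma_quotW => m1; apply: verma_quotW => m2.
rewrite -(linZ verma_pi_linear) -verma_piD !verma_act_pi.
by rewrite verma_free_act_linearr verma_pi_linear.
Qed.

Lemma verma_act_basis a b q :
  verma_act (sh_table (@eB K) a b) q =
    verma_act (eB K a) (verma_act (eB K b) q)
    - (-1) ^+ (sh_odd a && sh_odd b) *: verma_act (eB K b) (verma_act (eB K a) q).
Proof.
move: q; apply: verma_quotW => m; rewrite !verma_act_pi !verma_free_act_eB.
rewrite -(linZ verma_pi_linear) -(linN verma_pi_linear) -verma_piD.
exact/verma_piP/verma_null_br.
Qed.

Definition verma_module : lsaModule (SH K) :=
  sh_module verma_act_linearl verma_act_linearr verma_act_basis.

Definition verma_vector : verma_module := verma_pi (verma_word [::]).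

Lemma verma_hw_vector : highest_weight cL cLA h hA verma_vector.
Proof.
have act_eB b m : lsm_act (eB K b : SH K) (verma_pi m : verma_module)
    = verma_pi (verma_op b m).
  by rewrite [LHS]verma_act_pi verma_free_act_eB.
split.
- move=> x hx; rewrite [LHS]verma_act_pi -(lin0 verma_pi_linear).
  apply/verma_piP; rewrite subr0 /verma_free_act /lin_ext.
  have : {subset enum_fset (msupp (x : {malg K[sh_basis]})) <= sh_plus_basis}.
    by move=> b /hx.
  elim: (enum_fset _) => [|b l IH] sub; first by rewrite big_nil; exact: verma_null0.
  rewrite big_cons; apply: verma_null_linear.
    by apply/verma_null_plus/(sub b); rewrite inE eqxx.
  by apply: IH => c cl; apply: sub; rewrite inE cl orbT.
- rewrite [LHS]act_eB -(linZ verma_pi_linear).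
  exact/verma_piP/verma_null_L0.
- rewrite [LHS]act_eB -(linZ verma_pi_linear).
  exact/verma_piP/verma_null_alpha0.
- apply: verma_quotW => m; rewrite [LHS]act_eB -(linZ verma_pi_linear).
  exact/verma_piP/verma_null_CL.
- apply: verma_quotW => m; rewrite [LHS]act_eB -(lin0 verma_pi_linear).
  by apply/verma_piP; rewrite subr0; exact: verma_null_CAlpha.
apply: verma_quotW => m; rewrite [LHS]act_eB -(linZ verma_pi_linear).
exact/verma_piP/verma_null_CLAlpha.
Qed.

Lemma verma_word_ind (P : verma_free -> Prop) :
  P 0 -> (forall a x y, P x -> P y -> P (a *: x + y)) ->
  (forall s, P (verma_word s)) -> forall m, P m.
Proof.
move=> P0 PD Pw m; rewrite [m]monalgE.
elim: (enum_fset _) => [|s l IH]; first by rewrite big_nil.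
rewrite big_cons; have -> : << m@_s *g s >> = m@_s *: verma_word s.
  by apply/malgP => k; rewrite mcoeffZ !mcoeffU mulr_natr.
exact: PD.
Qed.

Lemma verma_vector_generated : lsm_generated verma_vector.
Proof.
move=> P Pv PD Pact; apply: verma_quotW.
apply: verma_word_ind => [|a x y hx hy|s].
- by have := PD (-1) _ _ Pv Pv; rewrite scaleN1r addNr (lin0 verma_pi_linear).
- by rewrite verma_pi_linear; apply: PD.
elim: s => [//|b s IH]; have := Pact (eB K b) _ IH.
by rewrite [lsm_act _ _]verma_act_pi verma_free_act_eB /verma_op lin_extU.
Qed.

Section Universal.
Variables (W : lsaModule (SH K)) (w : W).
Hypothesis hw_w : highest_weight cL cLA h hA w.

Definition verma_eval : verma_free -> W :=
  lin_ext (foldr (fun b u => lsm_act (eB K b : SH K) u) w).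

Lemma verma_eval_linear : linear verma_eval.
Proof. exact: lin_ext_linear. Qed.

Lemma verma_eval_op b m :
  verma_eval (verma_op b m) = lsm_act (eB K b : SH K) (verma_eval m).
Proof.
move: m; apply: verma_word_ind => [|a x y hx hy|s].
- rewrite (lin0 (verma_op_linear b)) (lin0 verma_eval_linear).
  by rewrite (lin0 (lsm_act_linearr _)).
- rewrite verma_op_linear !verma_eval_linear hx hy.
  by rewrite lsm_act_linearr.
by rewrite /verma_op /verma_eval !lin_extU.
Qed.

Lemma verma_eval_act x m :
  verma_eval (verma_free_act x m) = lsm_act x (verma_eval m).
Proof.
move: x; apply: sh_basis_ext => [||b].
- exact: (linear_comp verma_eval_linear (verma_free_act_linearl m)).
- exact: (@lsm_act_linearl _ _ W).
by rewrite verma_free_act_eB verma_eval_op.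
Qed.

Lemma sh_plus_eB b : sh_plus_basis b -> sh_plus (eB K b : SH K).
Proof. by move=> hb c /(fsubsetP msuppU_le); rewrite in_fset1 => /eqP ->. Qed.

Lemma verma_eval_null m : verma_null m -> verma_eval m = 0.
Proof.
have ev1 : verma_eval (verma_word [::]) = w by rewrite /verma_eval lin_extU.
have evE := (linD verma_eval_linear, linN verma_eval_linear,
  linZ verma_eval_linear).
elim=> {m} [|a x y _ hx _ hy|b x _ hx|a b m|b hb|||m|m|m].
- exact: (lin0 verma_eval_linear).
- by rewrite verma_eval_linear hx hy scaler0 addr0.
- by rewrite verma_eval_op hx (lin0 (lsm_act_linearr _)).
- have hab : lsm_act (sh_table (@eB K) a b : SH K) (verma_eval m) =
      lsm_act (eB K a : SH K) (lsm_act (eB K b : SH K) (verma_eval m))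
      - (-1) ^+ (sh_odd a && sh_odd b) *:
        lsm_act (eB K b : SH K) (lsm_act (eB K a : SH K) (verma_eval m)).
    have := @lsm_act_br K (SH K) W _ _ (eB K a) (eB K b) (verma_eval m)
      (@sh_hom_eB K a) (@sh_hom_eB K b).
    by rewrite [lsa_br _ _]sh_br_eB.
  pose lhs := verma_free_act (sh_table (@eB K) a b) m.
  pose ab := verma_op a (verma_op b m); pose ba := verma_op b (verma_op a m).
  have e_ab : verma_eval ab = lsm_act (eB K a : SH K)
      (lsm_act (eB K b : SH K) (verma_eval m)) by rewrite /ab !verma_eval_op.
  have e_ba : verma_eval ba = lsm_act (eB K b : SH K)
      (lsm_act (eB K a : SH K) (verma_eval m)) by rewrite /ba !verma_eval_op.
  have e_lhs : verma_eval lhs = _ := etrans (verma_eval_act _ _) hab.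
  rewrite -/lhs -/ab -/ba; clearbody lhs ab ba.
  by rewrite !evE e_lhs e_ab e_ba subrr.
- by rewrite verma_eval_op ev1 (hw_plus hw_w) //; exact: sh_plus_eB.
- by rewrite !evE verma_eval_op ev1 [lsm_act _ _](hw_L0 hw_w) subrr.
- by rewrite !evE verma_eval_op ev1 [lsm_act _ _](hw_alpha0 hw_w) subrr.
- by rewrite !evE verma_eval_op [lsm_act _ _](hw_CL hw_w) subrr.
- by rewrite verma_eval_op [lsm_act _ _](hw_CAlpha hw_w).
by rewrite !evE verma_eval_op [lsm_act _ _](hw_CLAlpha hw_w) subrr.
Qed.

Lemma verma_module_universal :
  exists f : verma_module -> W, lsm_hom f /\ f verma_vector = w.
Proof.
pose f (q : verma_quot) := verma_eval (verma_repr q).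
have f_pi m : f (verma_pi m) = verma_eval m.
  apply/eqP; rewrite -subr_eq0 -(linN verma_eval_linear).
  by rewrite -(linD verma_eval_linear); apply/eqP/verma_eval_null/verma_null_repr.
exists f; split; last by rewrite f_pi /verma_eval lin_extU.
split=> [a|x].
  apply: verma_quotW => m1; apply: verma_quotW => m2.
  by rewrite -verma_pi_linear !f_pi verma_eval_linear.
apply: verma_quotW => m.
by rewrite [lsm_act _ _]verma_act_pi !f_pi verma_eval_act.
Qed.

End Universal.

Lemma verma_exists :
  exists (V : lsaModule (SH K)) (v : V), is_verma cL cLA h hA v.
Proof.
exists verma_module, verma_vector.
split; [exact: verma_hw_vector | exact: verma_vector_generated |].
by move=> W w; exact: verma_module_universal.
Qed.

End VermaExists.

(* Main.v *)
Require Import Defs.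
From mathcomp Require Import all_boot all_order all_algebra.
From mathcomp Require Import reals complex finmap monalg ring zify.

Set Implicit Arguments.
Unset Strict Implicit.
Unset Printing Implicit Defensive.

Import Order.TTheory GRing.Theory Num.Theory.
Local Open Scope ring_scope.

(** Write beta(-n) = - alpha(-n) / (2 c_{L,alpha}), S(z) for the exponential of
    the sum of the beta(-n) z^n / n, k = (p - 1) / 2, and S_k for the coefficients
    of S(z).

    Why u is singular. As C_alpha acts by zero, the alpha and the Psi
    supercommute, so alpha(n), n > 0, and Psi(s), s > 0, move through u to v and
    kill it. An operator D whose commutators with the beta(-n) commute with all
    of them acts on S(z) by the derivation rule (ops_exp_derivation). For
    D = G(m + 1/2), m >= 0, it gives
      G(m + 1/2) S_j v = - (2 c_{L,alpha})^-1 sum_i Psi(m - i + 1/2) S_(j-i) v,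
    so that G(m + 1/2) u has two parts. The part with two Psi is antisymmetric in
    them and vanishes (Psi_G_sum0). The other part comes from the anticommutators
    of G(m + 1/2) with the Psi and is a multiple of
      (alpha(0) - 2 (m + 1) c_{L,alpha}) S_(k-m) v + sum_(i > 0) alpha(-i) S_(k-m-i) v;
    the sum is - 2 c_{L,alpha} (k - m) S_(k-m) v by Euler's identity
    (schur_euler), and alpha(0) = (1 + p) c_{L,alpha} = (2 k + 2) c_{L,alpha} is the
    value for which the two terms cancel (Alpha_sum0). Finally the L(n), n > 0,
    are anticommutators of the G.

    Why u is nonzero. This is the Poincare-Birkhoff-Witt theorem for the Verma
    module, here in the form pbw_realization: there is a linear map from the Verma
    module to the free vector space on the sorted words in negative basis
    elements, which turns the action into straightening of words. The only point
    is that straightening satisfies the relations of the enveloping algebra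
    (super_rel_word); it is proved by induction on the length of words from the
    Jacobi identity. As the negative alpha and Psi supercommute without central
    terms, straightening keeps the length of words in them, so the term
    Psi(-k - 1/2) v of u, a word of length one, is cancelled by no other term. *)

(** * Vectors spanned by given basis elements *)

Section Spanned.
Variables (K : numFieldType) (B : choiceType).

Definition spanned (P : B -> Prop) (x : {malg K[B]}) : Prop :=
  forall b, b \in msupp x -> P b.

Lemma spanned_ind (P : B -> Prop) (T : {malg K[B]} -> Prop) :
  T 0 -> (forall a x y, T x -> T y -> T (a *: x + y)) ->
  (forall b, P b -> T (mkmalgU b 1)) -> forall x, spanned P x -> T x.
Proof.
move=> T0 TD Tb x; rewrite /spanned => hx; rewrite [x]monalgE.
set l := (X in \sum_(_ <- X) _); have sub : {subset l <= msupp x} by [].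
elim: l sub => [|b l IH] sub; first by rewrite big_nil.
rewrite big_cons; have -> : << x@_b *g b >> = x@_b *: mkmalgU b 1.
  by apply/malgP => k; rewrite mcoeffZ !mcoeffU mulr_natr.
apply: TD; last by apply: IH => c cl; apply: sub; rewrite inE cl orbT.
by apply/Tb/hx/sub; rewrite inE eqxx.
Qed.

Lemma spanned0 P : spanned P 0.
Proof. by move=> b; rewrite msupp0 in_fset0. Qed.

Lemma spanned_linear P a x y : spanned P x -> spanned P y -> spanned P (a *: x + y).
Proof.
move=> hx hy b /(fsubsetP (msuppD_le _ _)); rewrite in_fsetU.
case/orP => hb; last exact: hy.
by apply: hx; apply: (fsubsetP (msuppZ_le a x)).
Qed.

Lemma spannedU (P : B -> Prop) b : P b -> spanned P (mkmalgU b 1).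
Proof. by move=> Pb c /(fsubsetP msuppU_le); rewrite in_fset1 => /eqP ->. Qed.

Lemma spannedZ P a x : spanned P x -> spanned P (a *: x).
Proof. by move=> hx; rewrite -[_ *: _]addr0; apply: spanned_linear => //; exact: spanned0. Qed.

Lemma spannedD P x y : spanned P x -> spanned P y -> spanned P (x + y).
Proof. by move=> hx hy; rewrite -[x]scale1r; apply: spanned_linear. Qed.

Lemma spanned_sum P (I : Type) (r : seq I) (F : I -> {malg K[B]}) :
  (forall i, spanned P (F i)) -> spanned P (\sum_(i <- r) F i).
Proof.
move=> hF; elim: r => [|i r IH]; first by rewrite big_nil; exact: spanned0.
by rewrite big_cons; exact: spannedD.
Qed.

Lemma spanned_sub (P Q : B -> Prop) x :
  (forall b, P b -> Q b) -> spanned P x -> spanned Q x.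
Proof. by move=> PQ hx b hb; apply/PQ/hx. Qed.

Lemma spannedT x : spanned (fun=> True) x.
Proof. by []. Qed.

Lemma linear_ext_spanned (P : B -> Prop) (W : lmodType K) (F G : {malg K[B]} -> W) x :
  linear F -> linear G -> spanned P x ->
  (forall b, P b -> F (mkmalgU b 1) = G (mkmalgU b 1)) -> F x = G x.
Proof.
move=> hF hG hx hFG; move: x hx; apply: spanned_ind => // [|a x y ex ey].
  by rewrite (lin0 hF) (lin0 hG).
by rewrite hF hG ex ey.
Qed.

End Spanned.

Lemma spanned_lin_ext (K : numFieldType) (B C : choiceType) (P : B -> Prop)
    (Q : C -> Prop) (f : B -> {malg K[C]}) x :
  spanned P x -> (forall b, P b -> spanned Q (f b)) -> spanned Q (lin_ext f x).
Proof.
move=> hx hf; move: x hx; apply: spanned_ind.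
- by rewrite (lin0 (lin_ext_linear f)); exact: spanned0.
- by move=> a x y hx hy; rewrite lin_ext_linear; exact: spanned_linear.
by move=> b /hf; rewrite lin_extU.
Qed.

Lemma spanned_lin_extT (K : numFieldType) (B C : choiceType)
    (Q : C -> Prop) (f : B -> {malg K[C]}) x :
  (forall b, spanned Q (f b)) -> spanned Q (lin_ext f x).
Proof. by move=> hf; apply: (spanned_lin_ext (@spannedT _ _ x)) => b _. Qed.

Lemma lin_ext_eq (K : numFieldType) (B : choiceType) (W : lmodType K) (P : B -> Prop)
    (f g : B -> W) x :
  spanned P x -> (forall b, P b -> f b = g b) -> lin_ext f x = lin_ext g x.
Proof.
move=> hx hfg; apply: linear_ext_spanned (lin_ext_linear _) (lin_ext_linear _) hx _.
by move=> b /hfg; rewrite !lin_extU.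
Qed.

Local Opaque lin_ext sh_br.

(** * Straightening words into the PBW basis *)

Section Straightening.
Variables (K : numFieldType) (lambda : sh_basis -> K).
Notation M := (verma_free K).
Notation word := (@verma_word K).
Notation brB a b := (sh_br (eB K a) (eB K b)).

Definition sh_minus_basis (b : sh_basis) : bool :=
  match b with
  | bL n | bAlpha n | bG n | bPsi n => n < 0
  | _ => false
  end.

(** Any total order on the negative basis elements gives a PBW basis; this one
    comes from a numbering. *)
Definition sh_key (b : sh_basis) : nat := choice.pickle (sh_basis_code b).

Lemma sh_key_inj : injective sh_key.
Proof. by move=> a b /(pcan_inj choice.pickleK) /(can_inj sh_basis_codeK). Qed.

(** An odd letter x cannot be repeated in a PBW word, because x x = [x, x] / 2 is a
    sum of shorter words. *)
Definition precedes : rel sh_basis :=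
  fun x y => (sh_key x < sh_key y)%N || (x == y) && ~~ sh_odd x.

Lemma precedes_trans : transitive precedes.
Proof.
move=> y x z; rewrite /precedes => /orP[xy|/andP[/eqP -> _]] //.
case/orP => [yz|/andP[/eqP <- _]]; last by rewrite xy.
by rewrite (ltn_trans xy yz).
Qed.

(** The elements outside the negative part count as larger than every letter. *)
Definition before (y x : sh_basis) : bool :=
  ~~ (sh_minus_basis x && ~~ precedes y x).

Definition before_or_eq (y x : sh_basis) : bool :=
  ~~ (sh_minus_basis x && ~~ ((x == y) || precedes y x)).

Definition pbw_word (w : seq sh_basis) : bool :=
  all sh_minus_basis w && sorted precedes w.

Definition fits (x : sh_basis) (w : seq sh_basis) : bool :=
  sh_minus_basis x && path precedes x w.

Lemma fitsE x w : pbw_word w -> fits x w = pbw_word (x :: w).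
Proof. by rewrite /fits /pbw_word /= -andbA => /andP[-> _]. Qed.

Lemma fits_all x w : pbw_word w -> fits x w = sh_minus_basis x && all (precedes x) w.
Proof. by rewrite /fits (path_sortedE precedes_trans) => /andP[_ ->]; rewrite andbT. Qed.

Lemma pbw_wordW x w : pbw_word (x :: w) -> pbw_word w.
Proof. by rewrite /pbw_word /= => /andP[/andP[_ ->] /path_sorted]. Qed.

Lemma pbw_word_fits x w : pbw_word (x :: w) -> fits x w.
Proof. by move=> h; rewrite fitsE // (pbw_wordW h). Qed.

(** The action of x on a PBW word of length at most n in the induced module: the
    letter x moves to the right through x y m = +/- y x m + [x, y] m, the square
    of an odd x being [x, x] / 2, until it fits or acts on the generator by
    lambda. The fuel n bounds the length of the word; it can stay the same for
    the inner factor of y (x m), because on the words of x m that are longer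
    than n the letter y fits, which costs no fuel. *)
Fixpoint straighten_rec (n : nat) (x : sh_basis) (w : seq sh_basis) : M :=
  if fits x w then word (x :: w) else
  match w, n with
  | [::], _ => lambda x *: word [::]
  | y :: m, n'.+1 =>
      if x == y then 2^-1 *: lin_ext (fun b => straighten_rec n' b m) (brB x x)
      else (-1) ^+ (sh_odd x && sh_odd y)
             *: lin_ext (straighten_rec n' y) (straighten_rec n' x m)
           + lin_ext (fun b => straighten_rec n' b m) (brB x y)
  | _, _ => 0
  end.

Definition straighten := locked straighten_rec.

Lemma straightenS n x y m : ~~ fits x (y :: m) ->
  straighten n.+1 x (y :: m) =
    if x == y then 2^-1 *: lin_ext (fun b => straighten n b m) (brB x x)
    else (-1) ^+ (sh_odd x && sh_odd y)
             *: lin_ext (straighten n y) (straighten n x m)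
         + lin_ext (fun b => straighten n b m) (brB x y).
Proof. by rewrite /straighten -lock => /negPf hf; rewrite /= hf. Qed.

Lemma straighten_nil n x : ~~ fits x [::] ->
  straighten n x [::] = lambda x *: word [::].
Proof. by rewrite /straighten -lock; case: n => [|n] /negPf /= ->. Qed.

Lemma straighten_fits n x w : fits x w -> straighten n x w = word (x :: w).
Proof. by rewrite /straighten -lock; case: n => [|n] h /=; case: w h => [|y m] ->. Qed.

(** Up to shorter words, straightening x w only sorts its letters. This is the
    compatibility with the length filtration on which the recursion and the
    inductions on length rest. *)
Definition leading x w w' : Prop :=
  pbw_word w' /\ ((size w' <= size w)%N \/ sh_minus_basis x /\ perm_eq w' (x :: w)).

Lemma leading_size x w w' : leading x w w' -> (size w' <= (size w).+1)%N.
Proof. by case=> _ [h|[_ /perm_size ->]] //; exact: leqW. Qed.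

Lemma precedes_total x y : x != y -> ~~ precedes x y -> precedes y x.
Proof.
rewrite /precedes => xy; rewrite (negPf xy) /= orbF -leqNgt leq_eqVlt.
by rewrite (inj_eq sh_key_inj) eq_sym (negPf xy) /= => ->.
Qed.

(** A word of x m longer than m rearranges x m, and y may precede each of its
    letters: those of m because y m is sorted, and x by assumption. *)
Lemma fits_leading x y m w' : pbw_word (y :: m) -> before y x ->
  leading x m w' -> ~~ (size w' <= size m)%N -> fits y w'.
Proof.
move=> hym yx [hw' [->|[nx pw]]] // _.
have := pbw_word_fits hym; rewrite !fits_all ?(pbw_wordW hym) // => /andP[-> hm] /=.
by rewrite (perm_all _ pw) /= hm andbT; move: yx; rewrite /before nx /= negbK.
Qed.

Lemma unfit_before x y m : pbw_word (y :: m) -> ~~ fits x (y :: m) -> x != y ->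
  before y x.
Proof.
move=> hym; rewrite /before /fits /=; case: sh_minus_basis => //= hx xy.
rewrite negbK; apply: precedes_total => //; apply: contraNN hx => -> /=.
by case/andP: hym.
Qed.

Lemma straighten_leading n x w : pbw_word w -> (size w <= n)%N ->
  spanned (leading x w) (straighten n x w).
Proof.
have base m z v : pbw_word v -> fits z v -> spanned (leading z v) (straighten m z v).
  move=> hv hf; rewrite straighten_fits //; apply: spannedU; split.
    by rewrite -fitsE.
  by right; split=> //; case/andP: hf.
elim: n x w => [|n IH] x w hw hn; (have [hf|hf] := boolP (fits x w); first exact: base);
  case: w hw hn hf => [|y m] // hw hn hf.
- by rewrite straighten_nil //; apply: spannedZ; apply: spannedU; split=> //; left.
- by rewrite straighten_nil //; apply: spannedZ; apply: spannedU; split=> //; left.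
have hm := pbw_wordW hw.
have lower b w' : leading b m w' -> leading x (y :: m) w'.
  by move=> h; split; [case: h | left; exact: leading_size h].
rewrite (straightenS n hf); case: eqP => [_|/eqP xy].
  apply: spannedZ; apply: spanned_lin_extT => b.
  by apply: (spanned_sub (lower b)); exact: IH.
apply: spannedD; last first.
  apply: spanned_lin_extT => b.
  by apply: (spanned_sub (lower b)); exact: IH.
apply: spannedZ; apply: (spanned_lin_ext (IH x m hm hn)) => w' hw'.
case: (leqP (size w') (size m)) => sw.
  apply: (@spanned_sub _ _ (leading y w')); last by apply: IH; [case: hw' | exact: leq_trans sw hn].
  by move=> w'' h; split; [case: h | left; apply: leq_trans (leading_size h) _].
have hy : fits y w'.
  apply: (fits_leading hw _ hw'); last by rewrite -ltnNge.
  exact: (unfit_before hw hf xy).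
rewrite straighten_fits //; apply: spannedU; case: hw' => hw' hs; split; first by rewrite -fitsE.
case: hs => [|[nx pw]]; first by rewrite leqNgt sw.
right; split => //; apply: (@perm_trans _ (y :: x :: m)); first by rewrite perm_cons.
by apply/permP => a /=; rewrite addnCA.
Qed.

Lemma straighten_fuelS n x w : pbw_word w -> (size w <= n)%N ->
  straighten n.+1 x w = straighten n x w.
Proof.
elim: n x w => [|n IH] x w hw hn; (have [hf|hf] := boolP (fits x w);
  first by rewrite !straighten_fits);
  case: w hw hn hf => [|y m] // hw hn hf; try by rewrite !straighten_nil.
have hm := pbw_wordW hw.
rewrite (straightenS n.+1 hf) (straightenS n hf).
have e z : lin_ext (fun b => straighten n.+1 b m) (brB x z)
    = lin_ext (fun b => straighten n b m) (brB x z).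
  by apply: (lin_ext_eq (@spannedT _ _ _)) => b _; exact: IH.
case: eqP => [_|/eqP xy]; first by rewrite (e x).
rewrite (e y) (IH x m hm hn).
have -> // : lin_ext (straighten n.+1 y) (straighten n x m)
    = lin_ext (straighten n y) (straighten n x m).
apply: lin_ext_eq (straighten_leading hm hn) _ => w' hw'.
case: (leqP (size w') (size m)) => sw.
  by apply: IH; [case: hw' | apply: leq_trans sw hn].
have hy : fits y w'.
  apply: (fits_leading hw _ hw'); last by rewrite -ltnNge.
  exact: (unfit_before hw hf xy).
by rewrite (straighten_fits n.+1) // straighten_fits.
Qed.

Lemma straighten_fuel n x w : pbw_word w -> (size w <= n)%N ->
  straighten n x w = straighten (size w) x w.
Proof.
move=> hw /subnK <-; elim: (n - _)%N => // k IH.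
by rewrite addSn straighten_fuelS ?leq_addl.
Qed.

Definition pbw_op (x : sh_basis) : M -> M :=
  lin_ext (fun w => straighten (size w) x w).

Definition pbw_act (X : sh_space K) (m : M) : M := lin_ext (pbw_op ^~ m) X.

Lemma pbw_op_linear x : linear (pbw_op x).
Proof. exact: lin_ext_linear. Qed.

Lemma pbw_act_linearl m : linear (pbw_act ^~ m).
Proof. exact: lin_ext_linear. Qed.

Lemma pbw_act_linearr X : linear (pbw_act X).
Proof.
move=> a m1 m2.
have rhs_linear : linear (fun Y => a *: pbw_act Y m1 + pbw_act Y m2).
  by apply: linear_add; [apply: linear_scale|]; exact: pbw_act_linearl.
apply: (linear_ext_spanned (pbw_act_linearl _) rhs_linear (@spannedT _ _ X)).
by move=> b _; rewrite /pbw_act !lin_extU pbw_op_linear.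
Qed.

Lemma pbw_act_eB b m : pbw_act (eB K b) m = pbw_op b m.
Proof. exact: lin_extU. Qed.

Lemma pbw_opU x w : pbw_op x (word w) = straighten (size w) x w.
Proof. exact: lin_extU. Qed.

Lemma pbw_op_fits x w : fits x w -> pbw_op x (word w) = word (x :: w).
Proof. by move=> h; rewrite pbw_opU straighten_fits. Qed.

Lemma pbw_op_word x w : pbw_word w -> spanned (leading x w) (pbw_op x (word w)).
Proof. by move=> hw; rewrite pbw_opU; exact: straighten_leading. Qed.

Lemma pbw_op_nil x : ~~ sh_minus_basis x -> pbw_op x (word [::]) = lambda x *: word [::].
Proof. by move=> h; rewrite pbw_opU straighten_nil // /fits (negPf h). Qed.

Lemma pbw_act_lin_ext n w X : pbw_word w -> (size w <= n)%N ->
  lin_ext (fun b => straighten n b w) X = pbw_act X (word w).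
Proof.
move=> hw hn; apply: (lin_ext_eq (@spannedT _ _ _)) => b _.
by rewrite pbw_opU straighten_fuel.
Qed.

(** The defining relation of the enveloping algebra for the pair (x, y), tested on
    one vector. *)
Definition super_rel x y (m : M) : Prop :=
  pbw_act (brB x y) m =
    pbw_op x (pbw_op y m) - (-1) ^+ (sh_odd x && sh_odd y) *: pbw_op y (pbw_op x m).

Lemma sh_br_skewB a b :
  brB b a = - ((-1) ^+ (sh_odd a && sh_odd b) *: brB a b).
Proof. by rewrite !sh_br_eB sh_br_skew_basis. Qed.

Lemma super_relC x y m : super_rel x y m -> super_rel y x m.
Proof.
rewrite /super_rel (sh_br_skewB x y) => e.
rewrite (linN (pbw_act_linearl _)) (linZ (pbw_act_linearl _)) e.
rewrite andbC scalerBr opprB scalerA -expr2 sqrr_sign scale1r addrC [in RHS]addrC.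
by rewrite [RHS]addrC.
Qed.

(** When the smaller of the two letters fits, the relation holds by construction:
    it is the rule by which the product of the other two was defined. *)
Lemma super_rel_fits x y w : pbw_word (y :: w) -> before_or_eq y x -> super_rel x y (word w).
Proof.
move=> hyw yx; have hw := pbw_wordW hyw; have hf := pbw_word_fits hyw.
rewrite /super_rel (pbw_op_fits hf).
have [xy|xy] := eqVneq x y.
  subst x; rewrite andbb (pbw_op_fits hf); have [yo|ye] := boolP (sh_odd y).
    rewrite expr1 scaleN1r opprK pbw_opU.
    have nf : ~~ fits y (y :: w) by rewrite /fits /= /precedes ltnn yo andbF andbF.
    rewrite (straightenS _ nf) eqxx pbw_act_lin_ext // -scalerDl.
    have -> : 2^-1 + 2^-1 = 1 :> K by field.
    by rewrite scale1r.
  rewrite expr0 scale1r subrr; have := sh_br_skewB y y; rewrite (negPf ye) expr0 scale1r.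
  move=> e; have : 2 *: (brB y y) = 0.
    by rewrite -[2]/(1 + 1) scalerDl scale1r {1}e addNr.
  move/eqP; rewrite scaler_eq0 pnatr_eq0 /= => /eqP ->.
  exact: (lin0 (pbw_act_linearl _)).
move: yx; rewrite /before_or_eq (negPf xy) /= => yx.
have nf : ~~ fits x (y :: w).
  apply: contraNN yx; rewrite /fits /= => /andP[-> /= /andP[+ _]].
  by rewrite /precedes (negPf xy) orbF eq_sym (negPf xy) orbF -leqNgt => /ltnW.
rewrite pbw_opU (straightenS _ nf) (negPf xy) pbw_act_lin_ext //.
have -> : lin_ext (straighten (size w) y) (straighten (size w) x w) = pbw_op y (pbw_op x (word w)).
  rewrite pbw_opU; apply: lin_ext_eq (straighten_leading hw _) _ => // w' hw'.
  (* The fuel allows only words no longer than w, the others start with y. *)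
  case: (leqP (size w') (size w)) => sw; first by rewrite straighten_fuel //; case: hw'.
  by rewrite !straighten_fits //; apply: fits_leading hyw yx hw' _; rewrite -ltnNge.
by rewrite addrAC subrr add0r.
Qed.

End Straightening.

(** * The relations of the enveloping algebra *)

Section ModuleIdentities.
Variables (K : numFieldType) (W : lmodType K).

(** Enough linear functionals to check an identity of vectors coordinatewise,
    where it becomes an identity in the field K. *)
Definition separated : Prop := forall x y : W,
  (forall F : W -> K, (forall u v, F (u + v) = F u + F v) ->
    (forall a u, F (a *: u) = a * F u) -> (forall u, F (- u) = - F u) ->
    F x = F y) -> x = y.

Hypothesis sepW : separated.

Lemma super_rel_linear_identity (a s : K) (A B C D : W) :
  a *: (A - s *: B) + (C - s *: D) = a *: A + C - s *: (a *: B + D).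
Proof. by apply: sepW => F FD FZ FN; rewrite !(FD, FN, FZ); ring. Qed.

(** The diamond for three letters with z the smallest: both sides of the relation
    of X and Y on Z mu are brought to the form with Z in front. X, Y, Z are the
    operators, BXY, BXZ, BYZ those of the brackets, J and YXZ stand for
    [[x, y], z] mu and [y, [x, z]] mu, and the Jacobi identity is in the
    hypothesis on X (BYZ mu). *)
Lemma super_rel_step_identity (x y z : bool) (X Y Z BXY BXZ BYZ : W -> W)
    (J YXZ mu : W) :
  linear X -> linear Y -> linear Z ->
  X (Z mu) = (-1) ^+ (x && z) *: Z (X mu) + BXZ mu ->
  Y (Z mu) = (-1) ^+ (y && z) *: Z (Y mu) + BYZ mu ->
  X (Z (Y mu)) = (-1) ^+ (x && z) *: Z (X (Y mu)) + BXZ (Y mu) ->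
  Y (Z (X mu)) = (-1) ^+ (y && z) *: Z (Y (X mu)) + BYZ (X mu) ->
  X (BYZ mu) = J + (-1) ^+ (x && y) *: YXZ + (-1) ^+ (x && (y (+) z)) *: BYZ (X mu) ->
  Y (BXZ mu) = YXZ + (-1) ^+ (y && (x (+) z)) *: BXZ (Y mu) ->
  BXY (Z mu) = J + (-1) ^+ ((x (+) y) && z) *: Z (BXY mu) ->
  BXY mu = X (Y mu) - (-1) ^+ (x && y) *: Y (X mu) ->
  BXY (Z mu) = X (Y (Z mu)) - (-1) ^+ (x && y) *: Y (X (Z mu)).
Proof.
move=> lX lY lZ hxz hyz hxzy hyzx hx_yz hy_xz -> ->.
rewrite hxz hyz (linD lX) (linD lY) (linD lZ) (linN lZ) (linZ lX) (linZ lY) (linZ lZ).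
rewrite hxzy hyzx hx_yz hy_xz; apply: sepW => F FD FZ FN; rewrite !(FD, FN, FZ).
by case: x y z {hxz hyz hxzy hyzx hx_yz hy_xz} => [] [] []; rewrite /= ?expr0 ?expr1; ring.
Qed.

(** The same for y = z odd, where moving Z past itself is the rule Z Z = [z, z]/2;
    J stands for [[x, z], z] mu, and [x, [z, z]] = 2 [[x, z], z]. *)
Lemma super_rel_odd_identity (x : bool) (X Z BXZ BZZ : W -> W) (J mu : W) :
  linear X -> linear Z ->
  2 *: Z (Z mu) = BZZ mu -> 2 *: Z (Z (X mu)) = BZZ (X mu) ->
  X (BZZ mu) = 2 *: J + BZZ (X mu) ->
  X (Z mu) = (-1) ^+ x *: Z (X mu) + BXZ mu ->
  BXZ (Z mu) = J - (-1) ^+ x *: Z (BXZ mu) ->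
  BXZ (Z mu) = X (Z (Z mu)) - (-1) ^+ x *: Z (X (Z mu)).
Proof.
move=> lX lZ hzz hzzx hx_zz hxz ->.
have -> : X (Z (Z mu)) = 2^-1 *: X (BZZ mu).
  by rewrite -hzz (linZ lX) scalerA mulVf ?pnatr_eq0 // scale1r.
rewrite hx_zz hxz (linD lZ) (linZ lZ) -hzzx.
by apply: sepW => F FD FZ FN; rewrite !(FD, FN, FZ); case: x {hxz}; rewrite /= ?expr0 ?expr1; field.
Qed.

End ModuleIdentities.

Local Opaque eB pbw_op pbw_act.

Section Relations.
Variables (K : numFieldType) (lambda : sh_basis -> K).
Notation M := (verma_free K).
Notation word := (@verma_word K).
Notation brB a b := (sh_br (eB K a) (eB K b)).
Notation pbw_op := (pbw_op lambda).
Notation pbw_act := (pbw_act lambda).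
Notation super_rel := (super_rel lambda).
Notation sgn x y := ((-1) ^+ (sh_odd x && sh_odd y)).

Let pbw_opE x := (linD (pbw_op_linear lambda x), linZ (pbw_op_linear lambda x),
  linN (pbw_op_linear lambda x)).

Lemma verma_free_separated : separated M.
Proof.
move=> x y h; apply/malgP => k; apply: (h (fun u => u@_k)).
- exact: mcoeffD.
- by move=> a u; exact: mcoeffZ.
- exact: mcoeffN.
Qed.

Lemma super_rel_linear x y a m1 m2 :
  super_rel x y m1 -> super_rel x y m2 -> super_rel x y (a *: m1 + m2).
Proof.
rewrite /super_rel pbw_act_linearr => -> ->; rewrite !pbw_opE.
exact: super_rel_linear_identity verma_free_separated _ _ _ _ _ _.
Qed.

Lemma super_rel0 x y : super_rel x y 0.
Proof.
by rewrite /super_rel (lin0 (pbw_act_linearr _ _)) !(lin0 (pbw_op_linear _ _)) scaler0 subr0.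
Qed.

Lemma super_rel_spanned (P : seq sh_basis -> Prop) x y m :
  spanned P m -> (forall w, P w -> super_rel x y (word w)) -> super_rel x y m.
Proof.
move=> hm hP; apply: (@spanned_ind _ _ P (super_rel x y) _ _ _ m hm).
- exact: super_rel0.
- by move=> a m1 m2; exact: super_rel_linear.
- exact: hP.
Qed.

Lemma super_rel_hom x m t Y : (forall b, super_rel x b m) -> sh_hom t Y ->
  pbw_op x (pbw_act Y m) =
    pbw_act (sh_br (eB K x) Y) m + (-1) ^+ (sh_odd x && t) *: pbw_act Y (pbw_op x m).
Proof.
move=> hx hY; move: Y hY; apply: sh_hom_ext => [||b <-].
- exact: (linear_comp (pbw_op_linear _ _) (pbw_act_linearl _ _)).
- apply: linear_add; first exact: (linear_comp (pbw_act_linearl _ _) (sh_br_linearr _)).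
  by apply: linear_scale; exact: pbw_act_linearl.
by rewrite hx !pbw_act_eB subrK.
Qed.

Lemma super_rel_homr z m t Y : (forall b, super_rel b z m) -> sh_hom t Y ->
  pbw_act Y (pbw_op z m) =
    pbw_act (sh_br Y (eB K z)) m + (-1) ^+ (t && sh_odd z) *: pbw_op z (pbw_act Y m).
Proof.
move=> hz hY; move: Y hY; apply: sh_hom_ext => [||b <-].
- exact: pbw_act_linearl.
- apply: linear_add; first exact: (linear_comp (pbw_act_linearl _ _) (sh_br_linearl _)).
  by apply: linear_scale; exact: (linear_comp (pbw_op_linear _ _) (pbw_act_linearl _ _)).
by rewrite hz !pbw_act_eB subrK.
Qed.

Lemma super_rel_swap x y m : super_rel x y m ->
  pbw_op x (pbw_op y m) = sgn x y *: pbw_op y (pbw_op x m) + pbw_act (brB x y) m.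
Proof. by move=> ->; rewrite addrCA subrr addr0. Qed.

Lemma brB_hom x y : sh_hom (sh_odd x (+) sh_odd y) (brB x y).
Proof. by apply: sh_br_hom; exact: sh_hom_eB. Qed.

Lemma brB_jacobi x y z :
  sh_br (eB K x) (brB y z) = sh_br (brB x y) (eB K z)
    + sgn x y *: sh_br (eB K y) (brB x z).
Proof. exact: sh_jacobi_basis. Qed.

Lemma brB_skew_hom x t Y : sh_hom t Y ->
  sh_br (eB K x) Y = - ((-1) ^+ (t && sh_odd x) *: sh_br Y (eB K x)).
Proof. by move=> hY; apply: sh_br_skew => //; exact: sh_hom_eB. Qed.

Section Step.
Variable m : seq sh_basis.
Variable z : sh_basis.
Hypothesis zm : pbw_word (z :: m).
Hypothesis rel_short : forall w, pbw_word w -> (size w <= size m)%N ->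
  forall x y, super_rel x y (word w).

Let hm : pbw_word m := pbw_wordW zm.

Let rel_m x y : super_rel x y (word m) := rel_short hm (leqnn _) x y.

(** The vector y m may have words one letter longer than m, out of reach of the
    induction; on those z fits, unless z is y and odd. *)
Lemma super_rel_op x y : before_or_eq z x -> before_or_eq z y -> ~~ ((y == z) && sh_odd z) ->
  super_rel x z (pbw_op y (word m)).
Proof.
move=> zx zy yz; apply: (super_rel_spanned (pbw_op_word hm)) => w hw.
case: (leqP (size w) (size m)) => sw; first by apply: rel_short; case: hw.
apply: super_rel_fits => //; rewrite -fitsE; last by case: hw.
apply: (fits_leading zm _ hw); last by rewrite -ltnNge.
apply: contraNN zy => /andP[ny nzy]; rewrite ny negb_or nzy andbT /=.
by apply: contraNN yz => /eqP e; move: nzy; rewrite e eqxx /precedes ltnn eqxx /= negbK.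
Qed.

Lemma super_rel_step_gen x y : before_or_eq z x -> before_or_eq z y ->
  ~~ ((x == z) && sh_odd z) -> ~~ ((y == z) && sh_odd z) ->
  super_rel x y (word (z :: m)).
Proof.
move=> zx zy xz yz; have hz := pbw_word_fits zm.
have ez : word (z :: m) = pbw_op z (word m) by rewrite pbw_op_fits.
have R1 x' : before_or_eq z x' -> super_rel x' z (word m) by move=> h; apply: super_rel_fits.
rewrite /super_rel ez; apply: (super_rel_step_identity verma_free_separated
  (pbw_op_linear _ x) (pbw_op_linear _ y) (pbw_op_linear _ z)
  (super_rel_swap (R1 _ zx)) (super_rel_swap (R1 _ zy))
  (super_rel_swap (super_rel_op zx zy yz)) (super_rel_swap (super_rel_op zy zx xz))
  _ (super_rel_hom (fun b => rel_m y b) (@brB_hom x z))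
  (super_rel_homr (fun b => rel_m b z) (@brB_hom x y)) (rel_m x y)).
rewrite (super_rel_hom (fun b => rel_m x b) (@brB_hom y z)) (brB_jacobi x y z).
by rewrite (linD (pbw_act_linearl _ _)) (linZ (pbw_act_linearl _ _)).
Qed.

Lemma super_rel_square mu : sh_odd z -> super_rel z z mu ->
  2 *: pbw_op z (pbw_op z mu) = pbw_act (brB z z) mu.
Proof.
by move=> zo; rewrite /super_rel zo expr1 scaleN1r opprK -[2]/(1 + 1) scalerDl !scale1r.
Qed.

Lemma brB_odd x : sh_odd z ->
  sh_br (eB K x) (brB z z) = 2 *: sh_br (brB x z) (eB K z).
Proof.
move=> zo; rewrite brB_jacobi (brB_skew_hom z (@brB_hom x z)) zo andbT andbT.
rewrite -[2]/(1 + 1) scalerDl !scale1r scalerN scalerA; congr (_ + _).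
by case: (sh_odd x); rewrite /= ?expr0 ?expr1 ?mulr1 ?mul1r ?scaleN1r ?opprK.
Qed.

(** By skew symmetry [z, [z, z]] is - [[z, z], z], and by the Jacobi identity it is
    2 [[z, z], z]. *)
Lemma brB_odd_cube : sh_odd z -> sh_br (brB z z) (eB K z) = 0.
Proof.
move=> zo; have := brB_odd z zo.
rewrite (brB_skew_hom z (@brB_hom z z)) addbb andFb expr0 scale1r => /eqP.
rewrite eq_sym -subr_eq0 opprK -{2}[sh_br _ _]scale1r -scalerDl scaler_eq0.
have -> : 2 + 1 = 3 :> K by ring.
by rewrite pnatr_eq0 /= => /eqP.
Qed.

Lemma super_rel_step_odd x : before_or_eq z x -> x != z -> sh_odd z ->
  super_rel x z (word (z :: m)).
Proof.
move=> zx xz zo; have hz := pbw_word_fits zm.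
have ez : word (z :: m) = pbw_op z (word m) by rewrite pbw_op_fits.
have zz : before_or_eq z z by rewrite /before_or_eq eqxx andbF.
have e1 := super_rel_swap (rel_m x z).
have e2 := super_rel_homr (fun b => rel_m b z) (@brB_hom x z).
have sgnz b : (-1) ^+ ((b (+) true) && true) = - (-1) ^+ b :> K.
  by case: b; rewrite /= ?expr0 ?expr1 ?opprK.
rewrite zo sgnz scaleNr in e2; rewrite zo andbT in e1.
rewrite /super_rel ez zo andbT.
apply: (super_rel_odd_identity (BZZ := pbw_act (brB z z))
  verma_free_separated (pbw_op_linear _ x) (pbw_op_linear _ z) (super_rel_square zo (rel_m z z))
  (super_rel_square zo (super_rel_op zz zx _)) _ e1 e2).
  by rewrite (negPf xz).
rewrite (super_rel_hom (fun b => rel_m x b) (@brB_hom z z)) (brB_odd x zo).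
rewrite addbb andbF expr0 scale1r; congr (_ + _).
exact: (linZ (pbw_act_linearl _ _)).
Qed.

(** Both x and y equal to the odd letter z: the two ways to bracket
    Z Z Z agree because [[z, z], z] = 0. *)
Lemma super_rel_step_cube : sh_odd z -> super_rel z z (word (z :: m)).
Proof.
move=> zo; have hz := pbw_word_fits zm.
have ez : word (z :: m) = pbw_op z (word m) by rewrite pbw_op_fits.
rewrite /super_rel ez (super_rel_homr (fun b => rel_m b z) (@brB_hom z z)).
rewrite (brB_odd_cube zo) (lin0 (pbw_act_linearl _ _)) add0r addbb andFb expr0 scale1r.
rewrite -(super_rel_square zo (rel_m z z)) (linZ (pbw_op_linear _ _)) zo expr1.
by rewrite scaleN1r opprK -[2]/(1 + 1) scalerDl !scale1r.
Qed.

Lemma super_rel_step x y : before_or_eq z x -> before_or_eq z y -> super_rel x y (word (z :: m)).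
Proof.
move=> zx zy; have [zo|ze] := boolP (sh_odd z); last first.
  by apply: super_rel_step_gen; rewrite ?(negPf ze) ?andbF.
have [xz|xz] := eqVneq x z; have [yz|yz] := eqVneq y z.
- by rewrite xz yz; exact: super_rel_step_cube.
- by rewrite xz; apply: super_relC; exact: super_rel_step_odd.
- by rewrite yz; exact: super_rel_step_odd.
by apply: super_rel_step_gen; rewrite ?(negPf xz) ?(negPf yz).
Qed.

End Step.

Hypothesis lambda_odd : forall x, sh_odd x -> lambda x = 0.
Hypothesis lambda_br : forall x y, ~~ sh_minus_basis x -> ~~ sh_minus_basis y ->
  pbw_act (brB x y) (word [::]) = 0.

Lemma super_rel_nil x y : super_rel x y (word [::]).
Proof.
have pbw1 b : sh_minus_basis b -> pbw_word [:: b] by rewrite /pbw_word /= => ->.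
have [ny|ny] := boolP (sh_minus_basis y).
  have [nx|nx] := boolP (sh_minus_basis x).
    case: (boolP ((x == y) || precedes y x)) => xy.
      by apply: super_rel_fits; rewrite ?pbw1 // /before_or_eq xy andbF.
    apply/super_relC/super_rel_fits; first exact: pbw1.
    move: xy; rewrite negb_or => /andP[xy yx].
    by rewrite /before_or_eq (precedes_total _ yx) ?orbT ?andbF // eq_sym.
  by apply: super_rel_fits; rewrite ?pbw1 // /before_or_eq (negPf nx).
have [nx|nx] := boolP (sh_minus_basis x).
  by apply/super_relC/super_rel_fits; rewrite ?pbw1 // /before_or_eq (negPf ny).
rewrite /super_rel lambda_br // !pbw_op_nil // !(linZ (pbw_op_linear _ _)) !pbw_op_nil //.
rewrite !scalerA -scalerBl; have [/andP[xo yo]|_] := boolP (sh_odd x && sh_odd y).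
  by rewrite lambda_odd // !(mul0r, mulr0) subrr scale0r.
by rewrite expr0 mul1r mulrC subrr scale0r.
Qed.

(** Induction on length: if x or y comes strictly before the first letter, the
    smaller of the two fits; otherwise the first letter is the smallest of the
    three and the diamond applies. On the empty word, the relation for two
    nonnegative elements says that lambda is a character of the nonnegative
    part. *)
Lemma super_rel_word w : pbw_word w -> forall x y, super_rel x y (word w).
Proof.
have [n] := ubnP (size w); elim: n w => // n IH [|z m] sw hw x y; first exact: super_rel_nil.
have hm := pbw_wordW hw.
have short w' : pbw_word w' -> (size w' <= size m)%N -> forall x y, super_rel x y (word w').
  by move=> hw' sw'; apply: IH => //; apply: leq_ltn_trans sw' _.
have below x' y' : ~~ before_or_eq z x' -> super_rel x' y' (word (z :: m)).
  rewrite /before_or_eq negbK negb_or => /andP[nx /andP[xz /(precedes_total _) xz']].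
  have fx : pbw_word [:: x', z & m].
    by rewrite -fitsE // /fits nx /= xz' 1?eq_sym //; case/andP: (pbw_word_fits hw).
  have [xy|] := boolP (before_or_eq x' y'); first by apply/super_relC/super_rel_fits.
  rewrite /before_or_eq negbK negb_or => /andP[ny /andP[xy /(precedes_total _) xy']].
  have yx : precedes y' x' by rewrite xy' // eq_sym.
  apply: super_rel_fits; last by rewrite /before_or_eq yx orbT andbF.
  rewrite -fitsE // /fits ny /= (precedes_trans yx) ?xz' 1?eq_sym //.
  by case/andP: (pbw_word_fits hw).
have [zx|] := boolP (before_or_eq z x); last exact: below.
have [zy|] := boolP (before_or_eq z y); last by move=> /below h; apply: super_relC.
exact: (super_rel_step hw short).
Qed.

End Relations.

(** * The PBW normal form on Verma modules *)

Lemma lin_comb0 (K : numFieldType) (W : lmodType K) (a b : K) (u v : W) :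
  a = 0 -> b = 0 -> a *: u + b *: v = 0.
Proof. by move=> -> ->; rewrite !scale0r addr0. Qed.

Lemma lin_comb_sub0 (K : numFieldType) (W : lmodType K) (a b : K) (u v : W) :
  a = 0 -> b = 0 -> a *: u - b *: v = 0.
Proof. by move=> -> ->; rewrite !scale0r subr0. Qed.

Section Realization.
Variables (K : numFieldType) (cL cLA h hA : K).
Notation M := (verma_free K).
Notation word := (@verma_word K).
Notation brB a b := (sh_br (eB K a) (eB K b)).

Definition verma_character (b : sh_basis) : K :=
  match b with
  | bL n => if n == 0 then h else 0
  | bAlpha n => if n == 0 then hA else 0
  | bCL => cL
  | bCLAlpha => cLA
  | _ => 0
  end.

Notation pbw_op := (pbw_op verma_character).
Notation pbw_act := (pbw_act verma_character).
Notation super_rel := (super_rel verma_character).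

Lemma verma_character_odd x : sh_odd x -> verma_character x = 0.
Proof. by case: x. Qed.

Lemma verma_character_br x y : ~~ sh_minus_basis x -> ~~ sh_minus_basis y ->
  pbw_act (brB x y) (word [::]) = 0.
Proof.
have pairE (i j : int) : 0 <= i -> 0 <= j -> i + j = 0 -> i = 0 /\ j = 0 by lia.
have posE (i j : int) : 0 <= i -> 0 <= j -> (i + j + 1 == 0) = false by lia.
have actN := linN (pbw_act_linearl verma_character (word [::])).
have actD := linD (pbw_act_linearl verma_character (word [::])).
have actZ := linZ (pbw_act_linearl verma_character (word [::])).
have act0 := lin0 (pbw_act_linearl verma_character (word [::])).
have opE b : ~~ sh_minus_basis b ->
    pbw_act (eB K b) (word [::]) = verma_character b *: word [::].
  by move=> hb; rewrite pbw_act_eB pbw_op_nil.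
rewrite sh_br_eB; case: x => [m|m|m|m|||]; case: y => [n|n|n|n|||] //=;
  rewrite -?leNgt => hm hn; rewrite ?act0 //.
all: rewrite /br_L_L /br_L_Alpha /br_Alpha_Alpha /br_Psi_Psi /br_G_G
    /br_L_G /br_Alpha_G /br_Psi_L /br_Psi_G /delta ?posE //.
all: rewrite ?(actN, actD, actZ) ?opE //= -?leNgt ?addr_ge0 ?posE //.
all: rewrite ?(mul0r, mulr0, scale0r, scaler0, addr0, oppr0) //.
all: case: eqP; rewrite ?(mul0r, mulr0, scale0r, scaler0, addr0, subr0, oppr0) //.
all: move=> /pairE e; try (have [-> ->] := e hm hn); try (have [-> ->] := e hn hm).
- by apply: lin_comb0; rewrite ?expr0n ?subrr ?subr0 ?mul0r ?mulr0.
- by apply: lin_comb_sub0; rewrite ?expr0n ?addr0 ?mulr0 ?mulr0z ?oppr0.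
by apply/eqP; rewrite oppr_eq0; apply/eqP; apply: lin_comb_sub0;
  rewrite ?expr0n ?addr0 ?mulr0 ?mulr0z ?oppr0.
Qed.

Definition normal_form : M -> M := lin_ext (foldr pbw_op (word [::])).

Lemma normal_form_linear : linear normal_form.
Proof. exact: lin_ext_linear. Qed.

Lemma normal_formU w : normal_form (word w) = foldr pbw_op (word [::]) w.
Proof. exact: lin_extU. Qed.

Lemma normal_form_op b m : normal_form (verma_op b m) = pbw_op b (normal_form m).
Proof.
apply: (linear_ext_spanned (linear_comp normal_form_linear (verma_op_linear b))
  (linear_comp (pbw_op_linear _ b) normal_form_linear) (@spannedT _ _ m)) => w _.
have -> : verma_op b (word w) = word (b :: w) by exact: lin_extU.
by rewrite !normal_formU.
Qed.

Lemma normal_form_act X m : normal_form (verma_free_act X m) = pbw_act X (normal_form m).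
Proof.
apply: (linear_ext_spanned (linear_comp normal_form_linear (verma_free_act_linearl m))
  (pbw_act_linearl _ _) (@spannedT _ _ X)) => b _.
by rewrite -/(eB K b) verma_free_act_eB pbw_act_eB normal_form_op.
Qed.

Lemma pbw_op_spanned b m : spanned pbw_word m -> spanned pbw_word (pbw_op b m).
Proof.
move: m; apply: spanned_ind => [|a x y hx hy|w hw].
- by rewrite (lin0 (pbw_op_linear _ _)); exact: spanned0.
- by rewrite pbw_op_linear; exact: spanned_linear.
by apply: spanned_sub (pbw_op_word hw) => w' [].
Qed.

Lemma normal_form_spanned m : spanned pbw_word (normal_form m).
Proof.
apply: spanned_lin_extT => w; elim: w => [|b w IH]; first exact: spannedU.
exact: pbw_op_spanned.
Qed.

Lemma super_rel_pbw x y m : spanned pbw_word m -> super_rel x y m.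
Proof.
move=> hm; apply: super_rel_spanned hm _ => w hw.
apply: super_rel_word => //; [exact: verma_character_odd | exact: verma_character_br].
Qed.

Lemma pbw_op_central c m : ~~ sh_odd c -> ~~ sh_minus_basis c ->
  (forall b, sh_table (@eB K) c b = 0) -> spanned pbw_word m ->
  pbw_op c m = verma_character c *: m.
Proof.
move=> ec nc cc hm.
apply: (linear_ext_spanned (pbw_op_linear _ c) _ hm).
  by move=> a x y; rewrite scalerDr !scalerA mulrC.
elim=> [|b w IH] hw; first exact: pbw_op_nil.
have hb := pbw_op_fits verma_character (pbw_word_fits hw).
have e1 := super_rel_swap (super_rel_pbw c b
  (@spannedU _ _ (fun w => pbw_word w) _ (pbw_wordW hw))).
rewrite (negPf ec) expr0 scale1r sh_br_eB cc (lin0 (pbw_act_linearl _ _)) addr0 in e1.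
have e2 : pbw_op c (word w) = verma_character c *: word w := IH (pbw_wordW hw).
have e3 := linZ (pbw_op_linear verma_character b) (verma_character c) (word w).
rewrite -/(word (b :: w)) -hb e1 e2; exact: e3.
Qed.

(** The relations of the Verma module hold on normal forms, so the normal form
    factors through the quotient. *)
Lemma normal_form_null m : verma_null cL cLA h hA m -> normal_form m = 0.
Proof.
have nfE := (linD normal_form_linear, linN normal_form_linear, linZ normal_form_linear).
elim=> {m} [|a x y _ hx _ hy|b x _ hx|a b m|b hb|||m|m|m].
- exact: (lin0 normal_form_linear).
- by rewrite normal_form_linear hx hy scaler0 addr0.
- by rewrite normal_form_op hx (lin0 (pbw_op_linear _ _)).
- have hab := super_rel_pbw a b (normal_form_spanned (m := m)).
  rewrite /super_rel sh_br_eB in hab.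
  pose lhs := verma_free_act (sh_table (@eB K) a b) m.
  pose ab := verma_op a (verma_op b m); pose ba := verma_op b (verma_op a m).
  have e_ab : normal_form ab = pbw_op a (pbw_op b (normal_form m)).
    by rewrite /ab !normal_form_op.
  have e_ba : normal_form ba = pbw_op b (pbw_op a (normal_form m)).
    by rewrite /ba !normal_form_op.
  have e_lhs : normal_form lhs = _ := etrans (normal_form_act _ _) hab.
  rewrite -/lhs -/ab -/ba; clearbody lhs ab ba.
  by rewrite !nfE e_lhs e_ab e_ba subrr.
- rewrite normal_form_op normal_formU pbw_op_nil; last first.
    by move: b hb => [] //= n; rewrite -leNgt // => /ltW.
  have -> : verma_character b = 0; last exact: scale0r.
  by move: b hb => [] //= n; case: eqP => // ->.
- rewrite !nfE normal_form_op normal_formU pbw_op_nil //; exact: subrr.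
- rewrite !nfE normal_form_op normal_formU pbw_op_nil //; exact: subrr.
- rewrite !nfE normal_form_op pbw_op_central //; [exact: subrr | exact: normal_form_spanned].
- rewrite normal_form_op pbw_op_central //; [exact: scale0r | exact: normal_form_spanned].
- rewrite !nfE normal_form_op pbw_op_central //; [exact: subrr | exact: normal_form_spanned].
Qed.

(** The half of the PBW theorem used to see that a vector is nonzero: the vectors
    of a Verma module have coordinates on the PBW words, where the algebra acts
    by straightening. *)
Lemma pbw_realization (V : lsaModule (SH K)) (v : V) : is_verma cL cLA h hA v ->
  exists g : V -> M, [/\ linear g,
    forall b w, g (lsm_act (eB K b : SH K) w) = pbw_op b (g w) & g v = word [::]].
Proof.
move=> [_ _ univ].
have [f [[f_linear f_act] fv]] := univ _ _ (verma_hw_vector cL cLA h hA).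
pose nf (q : verma_quot cL cLA h hA) := normal_form (verma_repr q).
have nf_pi m : nf (verma_pi cL cLA h hA m) = normal_form m.
  apply/eqP; rewrite -subr_eq0 -(linN normal_form_linear).
  by rewrite -(linD normal_form_linear); apply/eqP/normal_form_null/verma_null_repr.
exists (fun w => nf (f w)); split.
- apply: linear_comp f_linear => a.
  apply: verma_quotW => m1; apply: verma_quotW => m2.
  by rewrite -verma_pi_linear !nf_pi normal_form_linear.
- move=> b w; rewrite f_act; move: (f w); apply: verma_quotW => m.
  by rewrite [lsm_act _ _]verma_act_pi verma_free_act_eB !nf_pi normal_form_op.
by rewrite fv nf_pi normal_formU.
Qed.

End Realization.

(** * Derivations of exponentials of commuting operators *)

Lemma triangular_exchange (V : nmodType) (k : nat) (F : nat -> nat -> V) :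
  \sum_(i < k.+1) \sum_(j < (k - i).+1) F i j =
  \sum_(j < k.+1) \sum_(i < (k - j).+1) F i j.
Proof.
have widen (G : nat -> V) (i : 'I_k.+1) :
    \sum_(j < (k - i).+1) G j = \sum_(j < k.+1 | (i + j <= k)%N) G j.
  rewrite (big_ord_widen k.+1 G) ?ltnS ?leq_subr //; apply: eq_bigl => j /=.
  by rewrite ltnS leq_subRL // -ltnS.
under eq_bigr => i _ do rewrite (widen (F i)).
under [RHS]eq_bigr => j _ do rewrite (widen (fun i => F i j)).
rewrite (exchange_big_dep predT) //=.
by apply: eq_bigr => j _; apply: eq_bigl => i; rewrite addnC.
Qed.

Lemma linear_sum_fun (K : numFieldType) (V W : lmodType K) (D : V -> W)
    (I : Type) (r : seq I) (Q : pred I) (F : I -> V) :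
  linear D -> D (\sum_(i <- r | Q i) F i) = \sum_(i <- r | Q i) D (F i).
Proof. by move=> hD; apply: (big_morph D); [exact: linD | exact: lin0]. Qed.

Section SchurOperators.
Variables (K : numFieldType) (V : lmodType K) (f : nat -> V -> V).
Hypothesis f_linear : forall n, linear (f n).

Local Arguments iter : simpl never.
Local Notation P j := (iter j (ops_mul f) (@ops_one K V)).

Lemma ops_pow_high (f0 : forall w, f 0%N w = 0) j k w : (k < j)%N -> P j k w = 0.
Proof.
elim: j k => // j IH k kj; rewrite iterS /ops_mul big1 // => i _.
case: (posnP i) => [->|i0]; first by rewrite f0.
by rewrite IH ?(lin0 (f_linear _)) //; have := ltn_ord i; lia.
Qed.

(** The truncation of the exponential is immaterial beyond the degree, so the
    coefficients of different degrees may share one bound. *)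
Lemma ops_exp_wide (f0 : forall w, f 0%N w = 0) N k w : (k < N)%N ->
  ops_exp f k w = \sum_(j < N) (j`!%:R)^-1 *: P j k w.
Proof.
move=> kN; rewrite /ops_exp (big_ord_widen N (fun j => (j`!%:R)^-1 *: P j k w)) //.
rewrite [RHS](bigID (fun j : 'I_N => (j < k.+1)%N)) /= [X in _ + X]big1 ?addr0 // => j.
by rewrite -leqNgt => kj; rewrite ops_pow_high // scaler0.
Qed.

Section Derivation.
Variables (D : V -> V) (g : nat -> V -> V).
Hypothesis D_linear : linear D.
Hypothesis g_linear : forall n, linear (g n).
Hypothesis D_f : forall n w, D (f n w) = f n (D w) + g n w.
Hypothesis g_f : forall m n w, g m (f n w) = f n (g m w).

(** D f^(j+1) = f^(j+1) D + (j+1) g f^j, where g = [D, f] commutes with f. *)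
Lemma ops_pow_derivation j k w :
  D (P j.+1 k w) = P j.+1 k (D w) + j.+1%:R *: \sum_(i < k.+1) g i (P j (k - i)%N w).
Proof.
elim: j k => [|j IH] k.
  rewrite scale1r iterS /ops_mul (linear_sum_fun _ _ _ D_linear) -big_split.
  apply: eq_bigr => i _ /=; rewrite D_f; congr (f _ _ + _).
  by rewrite /iter /ops_one; case: ifP => // _; exact: lin0.
have powS l u : P j.+2 l u = \sum_(i < l.+1) f i (P j.+1 (l - i)%N u) by [].
rewrite !powS (linear_sum_fun _ _ _ D_linear).
under eq_bigr => i _ do rewrite D_f IH (linD (f_linear i)) (linZ (f_linear i)).
rewrite !big_split /= -addrA -scaler_sumr; congr (_ + _).
have -> : \sum_(i < k.+1) f i (\sum_(l < (k - i).+1) g l (P j (k - i - l)%N w)) =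
    \sum_(i < k.+1) g i (P j.+1 (k - i)%N w).
  transitivity (\sum_(i < k.+1) \sum_(l < (k - i).+1) f i (g l (P j (k - i - l)%N w))).
    by apply: eq_bigr => i _; exact: linear_sum_fun.
  rewrite (triangular_exchange k (fun i l => f i (g l (P j (k - i - l)%N w)))).
  apply: eq_bigr => i _; rewrite iterS /ops_mul (linear_sum_fun _ _ _ (g_linear i)).
  by apply: eq_bigr => l _; rewrite g_f subnAC.
by rewrite -[X in _ + X = _]scale1r -scalerDl natr1.
Qed.

(** D exp(f) = exp(f) D + g exp(f), where g = [D, f] commutes with f. *)
Lemma ops_exp_derivation (f0 : forall w, f 0%N w = 0) k w :
  D (ops_exp f k w) = ops_exp f k (D w) + \sum_(i < k.+1) g i (ops_exp f (k - i)%N w).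
Proof.
have kk : (k < k.+2)%N by lia.
rewrite !(ops_exp_wide f0 _ kk) (linear_sum_fun _ _ _ D_linear).
rewrite big_ord_recl [in RHS]big_ord_recl -addrA; congr (_ + _).
  rewrite (linZ D_linear) /=; congr (_ *: _).
  by rewrite /iter /ops_one; case: ifP => // _; exact: lin0.
have -> : \sum_(i < k.+1) g i (ops_exp f (k - i)%N w) =
    \sum_(j < k.+1) (j`!%:R)^-1 *: \sum_(i < k.+1) g i (P j (k - i)%N w).
  under eq_bigr => i _ do rewrite (ops_exp_wide f0 (N := k.+1)) ?ltnS ?leq_subr //
    (linear_sum_fun _ _ _ (g_linear i)).
  rewrite exchange_big; apply: eq_bigr => j _; rewrite scaler_sumr.
  by apply: eq_bigr => i _; rewrite (linZ (g_linear i)).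
rewrite -big_split; apply: eq_bigr => j _.
rewrite (linZ D_linear) lift0 ops_pow_derivation scalerDr; congr (_ + _).
rewrite scalerA factS natrM invfM mulrC mulrA divff ?mul1r //.
by rewrite pnatr_eq0.
Qed.

End Derivation.

Lemma ops_exp_degree (D : V -> V) (a : K) k v :
  linear D -> (forall n w, D (f n w) = f n (D w) + n%:R *: f n w) ->
  D v = a *: v -> D (ops_exp f k v) = (a + k%:R) *: ops_exp f k v.
Proof.
move=> D_linear D_f Dv.
have pow_degree j l : D (P j l v) = (a + l%:R) *: P j l v.
  elim: j l => [|j IH] l.
    rewrite /iter /ops_one; case: eqP => [->|_]; first by rewrite addr0.
    by rewrite (lin0 D_linear) scaler0.
  rewrite iterS /ops_mul (linear_sum_fun _ _ _ D_linear) scaler_sumr.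
  apply: eq_bigr => i _; rewrite D_f IH (linZ (f_linear i)) -scalerDl -addrA -natrD.
  by rewrite subnK // -ltnS.
rewrite /ops_exp (linear_sum_fun _ _ _ D_linear) scaler_sumr; apply: eq_bigr => j _.
by rewrite (linZ D_linear) pow_degree !scalerA mulrC.
Qed.

Lemma ops_exp0 k : ops_exp f k 0 = 0.
Proof.
have pow0 j l : P j l 0 = 0.
  elim: j l => [|j IH] l; first by rewrite /iter /ops_one; case: ifP.
  by rewrite iterS /ops_mul big1 // => i _; rewrite IH (lin0 (f_linear i)).
by rewrite /ops_exp big1 // => j _; rewrite pow0 scaler0.
Qed.

Lemma ops_exp_kill (f0 : forall w, f 0%N w = 0) (D : V -> V) k w :
  linear D -> (forall n u, D (f n u) = f n (D u)) -> D w = 0 -> D (ops_exp f k w) = 0.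
Proof.
move=> D_linear D_f Dw.
have zero_linear : linear (fun _ : V => 0 : V) by move=> a x y; rewrite scaler0 addr0.
have := ops_exp_derivation D_linear (fun=> zero_linear) _ _ f0 k w.
rewrite Dw ops_exp0 big1 // addr0; apply => *; rewrite ?addr0 //.
by rewrite (lin0 (f_linear _)).
Qed.

End SchurOperators.

(** * The equations of a singular vector *)

Section HighestWeight.
Variables (K : numFieldType) (cL cLA h hA : K) (V : lsaModule (SH K)) (v : V).
Hypothesis hw : highest_weight cL cLA h hA v.

Local Notation act b w := (@lsm_act _ _ V (eB K b : SH K) w).

Lemma act_linear b : linear (fun w : V => act b w).
Proof. exact: lsm_act_linearr. Qed.

Let actZ b a x : act b (a *: x) = a *: act b x := linZ (act_linear b) a x.
Let actD b x y : act b (x + y) = act b x + act b y := linD (act_linear b) x y.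
Let actN b x : act b (- x) = - act b x := linN (act_linear b) x.
Let act0 b : act b 0 = 0 := lin0 (act_linear b).

Lemma act_swap a b (w : V) :
  act a (act b w) = (-1) ^+ (sh_odd a && sh_odd b) *: act b (act a w)
    + lsm_act (sh_table (@eB K) a b : SH K) w.
Proof.
have -> : sh_table (@eB K) a b = lsa_br (eB K a : SH K) (eB K b) by rewrite [RHS]sh_br_eB.
by rewrite (lsm_act_br w (@sh_hom_eB K a) (@sh_hom_eB K b)) addrCA subrr addr0.
Qed.

Let tabD (x y : SH K) w : lsm_act (x + y) w = lsm_act x w + lsm_act y w :> V :=
  linD (@lsm_act_linearl _ _ V w) x y.
Let tabN (x : SH K) w : lsm_act (- x) w = - lsm_act x w :> V :=
  linN (@lsm_act_linearl _ _ V w) x.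
Let tabZ a (x : SH K) w : lsm_act (a *: x) w = a *: lsm_act x w :> V :=
  linZ (@lsm_act_linearl _ _ V w) a x.
Let tab0 w : lsm_act (0 : SH K) w = 0 :> V := lin0 (@lsm_act_linearl _ _ V w).
Let tabE := (tabD, tabN, tabZ, tab0).

Let act_CAlpha w : act bCAlpha w = 0 := hw_CAlpha hw w.
Let act_CLAlpha w : act bCLAlpha w = cLA *: w := hw_CLAlpha hw w.
Let act_Alpha0_v : act (bAlpha 0) v = hA *: v := hw_alpha0 hw.
Let act_L0_v : act (bL 0) v = h *: v := hw_L0 hw.

Lemma act_Alpha_Alpha m n w : act (bAlpha m) (act (bAlpha n) w) =
  act (bAlpha n) (act (bAlpha m) w).
Proof.
by rewrite act_swap expr0 scale1r /= /br_Alpha_Alpha tabE act_CAlpha scaler0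
  addr0.
Qed.

Lemma act_Alpha_Psi m n w : act (bAlpha m) (act (bPsi n) w) = act (bPsi n) (act (bAlpha m) w).
Proof. by rewrite act_swap expr0 scale1r /= tabE addr0. Qed.

Lemma act_Psi_Psi m n w : act (bPsi m) (act (bPsi n) w) = - act (bPsi n) (act (bPsi m) w).
Proof.
by rewrite act_swap expr1 scaleN1r /= /br_Psi_Psi tabE act_CAlpha scaler0
  addr0.
Qed.

Lemma act_G_Alpha m n w :
  act (bG m) (act (bAlpha n) w) = act (bAlpha n) (act (bG m) w) - n%:~R *: act (bPsi (n + m)) w.
Proof. by rewrite act_swap expr0 scale1r /= /br_Alpha_G !tabE. Qed.

Lemma act_G_Psi m n w :
  act (bG m) (act (bPsi n) w) = act (bAlpha (m + n + 1)) w
    + (2 * n%:~R * delta K (m + n + 1) * cLA) *: w - act (bPsi n) (act (bG m) w).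
Proof.
rewrite act_swap expr1 scaleN1r /= /br_Psi_G !tabE act_CLAlpha.
by rewrite scalerA addrC (addrC n m).
Qed.

Lemma act_L0_Alpha n w :
  act (bL 0) (act (bAlpha n) w) = act (bAlpha n) (act (bL 0) w) - n%:~R *: act (bAlpha n) w.
Proof.
rewrite act_swap expr0 scale1r /= /br_L_Alpha !tabE add0r expr0n addr0 mulr0z mulr0.
by rewrite scale0r subr0 scaleNr.
Qed.

Lemma act_L0_Psi n w :
  act (bL 0) (act (bPsi n) w) = act (bPsi n) (act (bL 0) w)
    - ((2 * n + 1)%:~R / 2) *: act (bPsi n) w.
Proof. by rewrite act_swap expr0 scale1r /= /br_Psi_L !tabE !addr0. Qed.

Lemma act_L_G_G (n : int) w : 0 <= n ->
  act (bL (n + 1)) w = 2^-1 *: (act (bG 0) (act (bG n) w) + act (bG n) (act (bG 0) w)).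
Proof.
move=> n0; rewrite (act_swap (bG 0)) expr1 scaleN1r /= /br_G_G !tabE add0r /delta.
have -> : (n + 1 == 0) = false by lia.
rewrite mul0r scale0r addr0 addrAC addNr add0r scalerA mulVf ?scale1r //.
by rewrite pnatr_eq0.
Qed.

Definition schur_term (n : nat) (w : V) : V :=
  if n == 0%N then 0 else n%:R^-1 *: (- (2 * cLA)^-1 *: act (bAlpha (- n%:Z)) w).

Lemma schur_alphaE k w : schur_alpha cLA k w = ops_exp schur_term k w.
Proof. by []. Qed.

Lemma schur_term0 w : schur_term 0 w = 0. Proof. by []. Qed.

Lemma schur_term_linear n : linear (schur_term n).
Proof.
rewrite /schur_term; case: eqP => _ a x y; first by rewrite scaler0 addr0.
by rewrite act_linear !scalerDr !scalerA; congr (_ *: _ + _ *: _); ring.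
Qed.

Lemma schur_term_commute D n w : linear D ->
  (forall u, D (act (bAlpha (- n%:Z)) u) = act (bAlpha (- n%:Z)) (D u)) ->
  D (schur_term n w) = schur_term n (D w).
Proof.
move=> hD hc; rewrite /schur_term; case: eqP => _; first exact: lin0.
by rewrite !(linZ hD) hc.
Qed.

Local Notation S k := (schur_alpha cLA k v).

Lemma schur_alpha_kill D k : linear D ->
  (forall n u, D (act (bAlpha n) u) = act (bAlpha n) (D u)) -> D v = 0 -> D (S k) = 0.
Proof.
move=> hD hc Dv; apply: ops_exp_kill => //; first exact: schur_term_linear.
by move=> n w; apply: schur_term_commute => // u; apply: hc.
Qed.

Lemma hw_act b : sh_plus_basis b -> act b v = 0.
Proof. by move=> hb; apply: (hw_plus hw); exact: sh_plus_eB. Qed.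

Lemma Alpha_schur (m : int) k : 0 < m -> act (bAlpha m) (S k) = 0.
Proof.
move=> m0; apply: schur_alpha_kill (act_linear _) _ _; last exact: hw_act.
by move=> n u; exact: act_Alpha_Alpha.
Qed.

Lemma Psi_schur (n : int) k : 0 <= n -> act (bPsi n) (S k) = 0.
Proof.
move=> n0; apply: schur_alpha_kill (act_linear _) _ _; last exact: hw_act.
by move=> m u; rewrite act_Alpha_Psi.
Qed.

Lemma Alpha0_schur k : act (bAlpha 0) (S k) = hA *: S k.
Proof.
apply/eqP; rewrite -subr_eq0; apply/eqP.
apply: (schur_alpha_kill k (D := fun w => act (bAlpha 0) w - hA *: w)).
- by apply: linear_add; [exact: act_linear | apply/linear_opp/linear_scale].
- by move=> n u; rewrite act_Alpha_Alpha actD actN actZ.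
by rewrite act_Alpha0_v subrr.
Qed.

Lemma L0_schur_term n w : act (bL 0) (schur_term n w) =
  schur_term n (act (bL 0) w) + n%:R *: schur_term n w.
Proof.
rewrite /schur_term; case: eqP => _; first by rewrite act0 scaler0 addr0.
rewrite !actZ act_L0_Alpha !scalerDr !scalerN !scalerA; congr (_ + _).
by rewrite -scaleNr; congr (_ *: _); rewrite mulrNz; ring.
Qed.

Lemma L0_schur k : act (bL 0) (S k) = (h + k%:R) *: S k.
Proof.
by apply: ops_exp_degree; [exact: schur_term_linear | exact: act_linear
  | exact: L0_schur_term | exact: (hw_L0 hw)].
Qed.

Lemma u_prE (p : nat) : u_pr cLA p v =
  \sum_(i < (p.-1)./2.+1) act (bPsi (- i%:Z - 1)) (S ((p.-1)./2 - i)).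
Proof. by []. Qed.

Lemma u_pr_Alpha (p : nat) (n : int) : 0 < n -> act (bAlpha n) (u_pr cLA p v) = 0.
Proof.
move=> n0; rewrite u_prE (linear_sum_fun _ _ _ (act_linear _)) big1 // => i _.
by rewrite act_Alpha_Psi Alpha_schur // act0.
Qed.

Lemma u_pr_Psi (p : nat) (n : int) : 0 <= n -> act (bPsi n) (u_pr cLA p v) = 0.
Proof.
move=> n0; rewrite u_prE (linear_sum_fun _ _ _ (act_linear _)) big1 // => i _.
by rewrite act_Psi_Psi Psi_schur // act0 oppr0.
Qed.

Lemma u_pr_L0 (p : nat) : odd p ->
  act (bL 0) (u_pr cLA p v) = (h + p%:R / 2) *: u_pr cLA p v.
Proof.
move=> podd; rewrite u_prE (linear_sum_fun _ _ _ (act_linear _)) scaler_sumr.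
set k := (p.-1)./2.
have pE : p = (2 * k + 1)%N by rewrite /k; lia.
apply: eq_bigr => i _; rewrite act_L0_Psi L0_schur actZ -scalerBl; congr (_ *: _).
have ik : (i <= k)%N by rewrite -ltnS.
have -> : (2 * (- i%:Z - 1) + 1)%:~R = - (2 * i%:R + 1) :> K.
  have -> : 2 * (- i%:Z - 1) + 1 = - (2 * i%:Z + 1) by ring.
  by rewrite mulrNz intrD intrM.
by rewrite natrB // pE (natrD _ (2 * k)%N) natrM; field.
Qed.

(** Euler's identity z S'(z) = (z f'(z)) S(z). The operator z d/dz is realized by
    L(0) - h, which kills v and multiplies S_k v by k. *)
Lemma schur_euler k : \sum_(i < k.+1) i%:R *: schur_term i (S (k - i)) = k%:R *: S k.
Proof.
have D_linear : linear (fun w : V => act (bL 0) w - h *: w).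
  by apply: linear_add; [exact: act_linear | apply/linear_opp/linear_scale].
have g_linear n : linear (fun w => n%:R *: schur_term n w).
  by apply: linear_scale; exact: schur_term_linear.
have D_f n w : act (bL 0) (schur_term n w) - h *: schur_term n w =
    schur_term n (act (bL 0) w - h *: w) + n%:R *: schur_term n w.
  rewrite L0_schur_term (linD (schur_term_linear n)) (linN (schur_term_linear n)).
  by rewrite (linZ (schur_term_linear n)) addrAC.
have comm m n w : schur_term m (schur_term n w) = schur_term n (schur_term m w).
  apply: schur_term_commute; first exact: schur_term_linear.
  move=> u; apply/esym/schur_term_commute; first exact: act_linear.
  by move=> u'; exact: act_Alpha_Alpha.
have g_f m n w : m%:R *: schur_term m (schur_term n w) = schur_term n (m%:R *: schur_term m w).
  by rewrite comm (linZ (schur_term_linear n)).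
have := ops_exp_derivation schur_term_linear D_linear g_linear D_f g_f schur_term0 k v.
have Dv : act (bL 0) v - h *: v = 0 by rewrite act_L0_v subrr.
rewrite Dv -/(S k) L0_schur -scalerBl addrAC subrr add0r => ->.
rewrite ops_exp0 ?add0r //; exact: schur_term_linear.
Qed.

Hypothesis cLA_neq0 : cLA != 0.

(** The commutator of G(m + 1/2) with the n-th term of the exponent. *)
Definition G_schur_coef (m : int) (n : nat) (w : V) : V :=
  if n == 0%N then 0 else - (2 * cLA)^-1 *: act (bPsi (m - n%:Z)) w.

Lemma G_schur m k : 0 <= m ->
  act (bG m) (S k) = \sum_(i < k.+1) - (2 * cLA)^-1 *: act (bPsi (m - i%:Z)) (S (k - i)).
Proof.
move=> m0.
have coef_linear n : linear (G_schur_coef m n).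
  rewrite /G_schur_coef; case: eqP => _; first by move=> a x y; rewrite scaler0 addr0.
  exact/linear_scale/act_linear.
have := ops_exp_derivation schur_term_linear (act_linear (bG m)) coef_linear _ _ schur_term0 k v.
rewrite hw_act // (ops_exp0 schur_term_linear) add0r => ->.
- rewrite big_ord_recl [RHS]big_ord_recl Psi_schur ?subr0 // scaler0.
  by rewrite {1}/G_schur_coef eqxx; congr (_ + _); apply: eq_bigr.
- move=> n w; rewrite /schur_term /G_schur_coef; case: eqP => [_|/eqP n0].
    by rewrite act0 addr0.
  rewrite !actZ act_G_Alpha !scalerDr !scalerN !scalerA; congr (_ + _).
  rewrite -scaleNr (addrC _ m); congr (_ *: _).
  by rewrite mulrNz; field; rewrite ?pnatr_eq0 ?n0 ?cLA_neq0.
move=> m' n w; rewrite /G_schur_coef; case: eqP => _.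
  by rewrite (lin0 (schur_term_linear _)).
rewrite (linZ (schur_term_linear _)); congr (_ *: _).
by apply: schur_term_commute; [exact: act_linear | move=> u; rewrite act_Alpha_Psi].
Qed.

Lemma G_schur_low (m k : nat) : (k <= m)%N -> act (bG m%:Z) (S k) = 0.
Proof.
move=> km; rewrite G_schur // big1 // => i _; rewrite Psi_schur ?scaler0 //.
by have := ltn_ord i; lia.
Qed.

Lemma G_schur_high (m k : nat) : act (bG m%:Z) (S (k + m.+1)) =
  \sum_(i < k.+1) - (2 * cLA)^-1 *: act (bPsi (- i%:Z - 1)) (S (k - i)).
Proof.
rewrite G_schur // -(big_mkord xpredT (fun i => _ *: act (bPsi (m%:Z - i%:Z)) (S (k + m.+1 - i)))).
rewrite -addSn addnC (big_cat_nat (n := m.+1)) ?leq_addr //= big_nat big1 ?add0r; last first.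
  by move=> i im; rewrite Psi_schur ?scaler0 //; lia.
rewrite -[X in \sum_(X <= _ < _) _]add0n big_addn addKn big_mkord; apply: eq_bigr => i _.
congr (_ *: lsm_act (eB K (bPsi _) : SH K) (S _)); [lia | lia].
Qed.

(** The Psi anticommute and S (k - i - j) is symmetric in i and j. *)
Lemma Psi_Psi_sum0 k :
  \sum_(i < k.+1) \sum_(j < (k - i).+1)
    act (bPsi (- i%:Z - 1)) (act (bPsi (- j%:Z - 1)) (S (k - i - j))) = 0.
Proof.
set X := \sum_(i < _) _.
have e : X = - X.
  rewrite {1}/X (triangular_exchange k (fun i j =>
    act (bPsi (- i%:Z - 1)) (act (bPsi (- j%:Z - 1)) (S (k - i - j)%N)))).
  rewrite -sumrN; apply: eq_bigr => j _; rewrite -sumrN; apply: eq_bigr => i _.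
  by rewrite act_Psi_Psi subnAC.
have : 2 *: X = 0 by rewrite -[2]/(1 + 1) scalerDl scale1r {1}e addNr.
by move/eqP; rewrite scaler_eq0 pnatr_eq0 /= => /eqP.
Qed.

Lemma Psi_G_sum0 (m k : nat) :
  \sum_(i < k.+1) act (bPsi (- i%:Z - 1)) (act (bG m%:Z) (S (k - i))) = 0.
Proof.
case: (leqP k m) => km.
  by rewrite big1 // => i _; rewrite G_schur_low ?act0 //; lia.
have [l ->] : exists l, k = (l + m.+1)%N by exists (k - m.+1)%N; lia.
(* Only i <= l contribute: otherwise l + m + 1 - i <= m, and G kills S. *)
rewrite -(big_mkord xpredT (fun i => act (bPsi (- i%:Z - 1)) (act (bG m%:Z) (S (l + m.+1 - i)%N)))).
rewrite (big_cat_nat (n := l.+1)) //=; last lia.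
rewrite [X in _ + X]big_nat [X in _ + X]big1 ?addr0; last first.
  by move=> i il; rewrite G_schur_low ?act0 //; lia.
rewrite big_mkord.
transitivity (- (2 * cLA)^-1 *: \sum_(i < l.+1) \sum_(j < (l - i).+1)
    act (bPsi (- i%:Z - 1)) (act (bPsi (- j%:Z - 1)) (S (l - i - j)))); last first.
  by rewrite Psi_Psi_sum0 scaler0.
rewrite scaler_sumr; apply: eq_bigr => i _.
have -> : (l + m.+1 - i = (l - i) + m.+1)%N by have := ltn_ord i; lia.
rewrite G_schur_high (linear_sum_fun _ _ _ (act_linear _)) scaler_sumr.
by apply: eq_bigr => j _; rewrite actZ.
Qed.

Lemma Alpha_schur_term n w : n != 0%N ->
  act (bAlpha (- n%:Z)) w = - (2 * cLA) *: (n%:R *: schur_term n w).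
Proof.
move=> n0; rewrite /schur_term (negPf n0) !scalerA.
rewrite (_ : _ * _ = 1) ?scale1r //; field.
by rewrite cLA_neq0 pnatr_eq0 n0.
Qed.

(** The terms with m < i add up to -2 cLA (k - m) S_(k-m) v by Euler's identity, and
    the term i = m is (hA - 2 (m + 1) cLA) S_(k-m) v: they cancel for this value
    of hA. *)
Lemma Alpha_sum0 (m k : nat) : hA = (2 * k + 2)%N%:R * cLA ->
  \sum_(i < k.+1) (act (bAlpha (m%:Z - i%:Z)) (S (k - i))
    - (2 * (i.+1)%:R * delta K (m%:Z - i%:Z) * cLA) *: S (k - i)) = 0.
Proof.
move=> hAE; case: (ltnP k m) => km.
  rewrite big1 // => i _; have im := ltn_ord i; rewrite Alpha_schur ?sub0r; last lia.
  have -> : delta K (m%:Z - i%:Z) = 0 by rewrite /delta; case: eqP => //; lia.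
  by rewrite mulr0 mul0r scale0r oppr0.
rewrite -(big_mkord xpredT (fun i => act (bAlpha (m%:Z - i%:Z)) (S (k - i)%N)
    - (2 * (i.+1)%:R * delta K (m%:Z - i%:Z) * cLA) *: S (k - i)%N)).
rewrite (big_cat_nat (n := m)) //=; last exact: leqW.
rewrite big_nat big1 ?add0r; last first.
  move=> i im; rewrite Alpha_schur; last lia.
  have -> : delta K (m%:Z - i%:Z) = 0 by rewrite /delta; case: eqP => //; lia.
  by rewrite mulr0 mul0r scale0r subr0.
rewrite -[X in \sum_(X <= _ < _) _]add0n big_addn subSn // big_mkord.
set N := (k - m)%N.
transitivity (\sum_(j < N.+1) (- (2 * cLA) *: (j%:R *: schur_term j (S (N - j)))
    + (if j == 0 :> nat then (2 * N%:R * cLA) *: S N else 0))).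
  apply: eq_bigr => j _; have -> : (k - (j + m) = N - j)%N by rewrite /N; lia.
  have -> : m%:Z - (j + m)%:Z = - j%:Z by lia.
  case: eqP => [j0|/eqP j0].
    rewrite j0 oppr0 subn0 Alpha0_schur schur_term0 !scaler0 add0r -scalerBl hAE /delta eqxx.
    congr (_ *: _); rewrite /N natrB // (natrD _ (2 * k)%N) natrM -natr1 add0n /=; ring.
  rewrite (Alpha_schur_term _ j0) addr0 /delta oppr_eq0.
  have -> : (j%:Z == 0) = false by lia.
  by rewrite mulr0 mul0r scale0r subr0.
rewrite big_split /= -scaler_sumr schur_euler (big_ord_recl N) eqxx /= big1 // addr0.
rewrite scalerA -scalerDl.
by rewrite (_ : _ + _ = 0) ?scale0r //; ring.
Qed.

(** Moving G(m + 1/2) past Psi produces the sum over the alpha, and moving it past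
    the Schur polynomial produces the sum over pairs of Psi; each vanishes. *)
Lemma u_pr_G (p : nat) (n : int) : odd p -> hA = (1 + p%:R) * cLA -> 0 <= n ->
  act (bG n) (u_pr cLA p v) = 0.
Proof.
case: n => // m podd hAE _; rewrite u_prE (linear_sum_fun _ _ _ (act_linear _)).
set k := (p.-1)./2.
have pE : p = (2 * k + 1)%N by rewrite /k; lia.
under eq_bigr => i _ do rewrite act_G_Psi.
rewrite big_split /= sumrN Psi_G_sum0 oppr0 addr0 -[RHS](Alpha_sum0 m (k := k)); last first.
  by rewrite hAE pE !natrD; congr (_ * _); ring.
apply: eq_bigr => i _.
have -> : m%:Z + (- i%:Z - 1) + 1 = m%:Z - i%:Z by ring.
rewrite -scaleNr; congr (_ + _ *: _); rewrite -natr1.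
have -> : (- i%:Z - 1)%:~R = - (i%:R + 1) :> K by rewrite -opprD mulrNz intrD.
ring.
Qed.

(** L(n + 1) is half of the anticommutator of G(1/2) and G(n + 1/2), so that it
    kills what the G kill. *)
Lemma u_pr_plus (p : nat) (x : SH K) : odd p -> hA = (1 + p%:R) * cLA ->
  sh_plus x -> lsm_act x (u_pr cLA p v) = 0.
Proof.
move=> podd hAE hx; set u := u_pr cLA p v.
have zero_linear : linear (fun _ : SH K => 0 : V) by move=> a y z; rewrite scaler0 addr0.
apply: (linear_ext_spanned (@lsm_act_linearl _ _ V u) zero_linear hx) => b hb.
have G0 n : 0 <= n -> act (bG n) u = 0 by exact: u_pr_G.
rewrite -/(eB K b); case: b hb => // n /= hn.
- have -> : n = (n - 1) + 1 by ring.
  by rewrite act_L_G_G ?G0 ?act0 ?addr0 ?scaler0 //; lia.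
- exact: u_pr_Alpha.
- exact: u_pr_Psi.
Qed.

End HighestWeight.

(** * Nonvanishing *)

Lemma eq_scaleN1_0 (K : numFieldType) (W : lmodType K) (A : W) : A = (-1) *: A -> A = 0.
Proof.
move=> e; have : 2 *: A = 0 by rewrite -[2]/(1 + 1) scalerDl !scale1r {1}e scaleN1r addNr.
by move/eqP; rewrite scaler_eq0 pnatr_eq0 /= => /eqP.
Qed.

Section NonVanishing.
Variables (K : numFieldType) (cL cLA h hA : K).
Notation M := (verma_free K).
Notation word := (@verma_word K).
Notation pbw_op := (pbw_op (verma_character cL cLA h hA)).

Definition alpha_psi (b : sh_basis) : bool :=
  match b with bAlpha n | bPsi n => n < 0 | _ => false end.

Lemma alpha_psi_minus b : alpha_psi b -> sh_minus_basis b.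
Proof. by case: b. Qed.

Lemma alpha_psi_br a b : alpha_psi a -> alpha_psi b -> sh_br (eB K a) (eB K b) = 0.
Proof.
rewrite sh_br_eB; case: a => // m ma; case: b => // n nb /=; rewrite //.
  rewrite /br_Alpha_Alpha /delta; have -> : (m + n == 0) = false by move: ma nb => /=; lia.
  by rewrite mul0r scale0r.
rewrite /br_Psi_Psi /delta; have -> : (m + n + 1 == 0) = false by move: ma nb => /=; lia.
by rewrite scale0r.
Qed.

Definition alpha_psi_word (n : nat) (w : seq sh_basis) : Prop :=
  [/\ pbw_word w, all alpha_psi w & size w = n].

(** The negative alpha and Psi supercommute, so straightening them never
    shortens a word. *)
Lemma alpha_psi_op_word x n w : alpha_psi x -> alpha_psi_word n w ->
  spanned (alpha_psi_word n.+1) (pbw_op x (word w)).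
Proof.
move=> hx; elim: n w => [|n IH] [|y m] [hw ha] //.
  have fx : fits x [::] by rewrite /fits alpha_psi_minus.
  by move=> _; rewrite pbw_op_fits //; apply: spannedU; split; rewrite -?fitsE //= hx.
case=> sm; have hm := pbw_wordW hw; move: (ha) => /= /andP[hy hma].
have [hf|hf] := boolP (fits x (y :: m)).
  have := hf; rewrite fitsE // => hxw; rewrite pbw_op_fits //.
  by apply: spannedU; split; rewrite //= ?hx ?hy ?hma ?sm.
have hyf := pbw_word_fits hw.
have swap := super_rel_swap (super_rel_pbw cL cLA h hA x y
  (@spannedU _ _ (fun w => pbw_word w) _ hm)).
rewrite (alpha_psi_br hx hy) (lin0 (pbw_act_linearl _ _)) addr0 in swap.
have ez : word (y :: m) = pbw_op y (word m) by rewrite pbw_op_fits.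
rewrite ez [X in spanned _ X]swap; apply: spannedZ.
have hxm : spanned (alpha_psi_word n.+1) (pbw_op x (word m)) by apply: IH.
have hxl := pbw_op_word (lambda := verma_character cL cLA h hA) (x := x) hm.
have [xy|xy] := eqVneq x y.
  subst y; have xo : sh_odd x.
    apply: contraNT hf => xe; rewrite /fits /= /precedes eqxx xe orbT.
    by case/andP: hyf => ->.
  rewrite (eq_scaleN1_0 (W := M) (A := pbw_op x (pbw_op x (word m)))); first exact: spanned0.
  by move: swap; rewrite xo.
apply: (spanned_lin_ext (P := fun w' => alpha_psi_word n.+1 w' /\ leading x m w')).
  by move=> w' hw'; split; [exact: hxm | exact: hxl].
move=> w' [[_ aw' sw'] lw'].
have hyw' : fits y w'.
  apply: (fits_leading hw (unfit_before hw hf xy) lw').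
  by rewrite sw' sm -ltnNge.
rewrite straighten_fits //; apply: spannedU; split; rewrite /= ?hy ?sw' //.
by case: lw' => h' _; rewrite -fitsE.
Qed.

Section Image.
Variables (V : lsaModule (SH K)) (v : V) (g : V -> M).
Hypothesis g_linear : linear g.
Hypothesis g_act : forall b w, g (lsm_act (eB K b : SH K) w) = pbw_op b (g w).
Hypothesis g_v : g v = word [::].

Definition alpha_psi_long (n : nat) (w : seq sh_basis) : Prop :=
  exists2 l, (n <= l)%N & alpha_psi_word l w.

Lemma alpha_psi_long_op x n m : alpha_psi x ->
  spanned (alpha_psi_long n) m -> spanned (alpha_psi_long n.+1) (pbw_op x m).
Proof.
move=> hx; move: m; apply: spanned_ind => [|a m1 m2 h1 h2|w [l nl hw]].
- by rewrite (lin0 (pbw_op_linear _ _)); exact: spanned0.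
- by rewrite pbw_op_linear; exact: spanned_linear.
apply: (@spanned_sub _ _ (alpha_psi_word l.+1)) (alpha_psi_op_word hx hw) => w' hw'.
by exists l.+1.
Qed.

Lemma g_schur_term n i w : spanned (alpha_psi_long n) (g w) ->
  spanned (alpha_psi_long n.+1) (g (schur_term cLA i w)).
Proof.
rewrite /schur_term; case: eqP => [_ _|/eqP i0 hw].
  by rewrite (lin0 g_linear); exact: spanned0.
rewrite !(linZ g_linear) g_act; apply: spannedZ; apply: spannedZ.
by apply: alpha_psi_long_op => //=; lia.
Qed.

Lemma g_schur k : (0 < k)%N -> spanned (alpha_psi_long 1) (g (schur_alpha cLA k v)).
Proof.
move=> k0; rewrite schur_alphaE /ops_exp (linear_sum_fun _ _ _ g_linear).
have pow j l : spanned (alpha_psi_long j)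
    (g (iter j (ops_mul (@schur_term K cLA V)) (@ops_one K V) l v)).
  elim: j l => [|j IH] l.
    rewrite /= /ops_one; case: eqP => _; last by rewrite (lin0 g_linear); exact: spanned0.
    by rewrite g_v; apply: spannedU; exists 0%N.
  rewrite iterS /ops_mul (linear_sum_fun _ _ _ g_linear).
  by apply: spanned_sum => i; apply: g_schur_term.
apply: spanned_sum => j; rewrite (linZ g_linear); apply: spannedZ.
case: (posnP j) => [j0|j0].
  by rewrite j0 /= /ops_one -[k == 0%N]negbK -lt0n k0 (lin0 g_linear); exact: spanned0.
apply: (@spanned_sub _ _ (alpha_psi_long j)) (pow j k) => w [l jl hw]; exists l => //.
exact: leq_trans jl.
Qed.

Lemma schur_alpha0 : schur_alpha cLA 0 v = v.
Proof. by rewrite schur_alphaE /ops_exp big_ord1 /= invr1 scale1r. Qed.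

(** The term Psi(-k - 1/2) v of u is a word of one letter, and all other terms
    are sums of longer words. *)
Lemma g_u_pr (p : nat) : g (u_pr cLA p v) != 0.
Proof.
set k := (p.-1)./2; pose b := bPsi (- k%:Z - 1).
have psi_ap (i : nat) : alpha_psi (bPsi (- i%:Z - 1)) by move=> /=; lia.
apply/eqP => /(congr1 (fun m : {malg K[seq sh_basis]} => m@_[:: b])).
rewrite u_prE (linear_sum_fun _ _ _ g_linear) -/k big_ord_recr /= subnn schur_alpha0.
rewrite g_act g_v pbw_op_fits ?mcoeffD ?mcoeffUU ?mcoeff0; last first.
  by rewrite /fits alpha_psi_minus.
rewrite mcoeff_outdom ?add0r; first by move/eqP; rewrite oner_eq0.
apply/negP => hb.
have : spanned (alpha_psi_long 2) (\sum_(i < k)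
    g (lsm_act (ePsi K (- i%:Z - 1) : SH K) (schur_alpha cLA (k - i) v))).
  apply: spanned_sum => i; rewrite g_act; apply: alpha_psi_long_op; first exact: psi_ap.
  by apply: g_schur; have := ltn_ord i; lia.
by move=> /(_ _ hb) [l l2 [_ _ /= l1]]; rewrite -l1 in l2.
Qed.

End Image.
End NonVanishing.

Theorem theorem4p2 (R : realType) (cL cLA : R[i]) (cLA_neq0 : cLA != 0)
    (p : nat) (p_odd : odd p) (r : R[i])
    (V : lsaModule (SH R[i])) (v : V)
    (vermaV : is_verma_pr cL cLA p%:R r v) :
  [/\ singular_vector (u_pr cLA p v),
      conformal_weight (u_pr cLA p v) (h_pr cL p%:R r + p%:R / 2)
    & h_pr cL p%:R r + p%:R / 2 = h_pr cL p%:R (r - 1 / 2)].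
Proof.
have hw := verma_hw vermaV; split.
- split; last by move=> x; exact: (u_pr_plus hw cLA_neq0).
  have [g [g_linear g_act g_v]] := pbw_realization vermaV.
  apply/eqP => u0; have := g_u_pr g_linear g_act g_v p.
  by rewrite u0 (lin0 g_linear) eqxx.
- exact: (u_pr_L0 hw p_odd).
by rewrite /h_pr; field.
Qed.
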